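(* Assume: (Smoothness) for each $i\in\{1,\dots,n\}$, $f_i$ is differentiable in $u$ and in $v_i$, $\nabla_u f_i(u,v_i)$ is $L_u$-Lipschitz in $u$ and $L_{uv}$-Lipschitz in $v_i$, $\nabla_v f_i(u,v_i)$ is $L_v$-Lipschitz in $v_i$ and $L_{vu}$-Lipschitz in $u$; put $L=\max\{L_u,L_v,L_{uv},L_{vu}\}$. (Stochastic gradients) for each $i$ and all $u,v_i$, $\mathbb{E}[\nabla_u F(u,v_i;\xi_i)]=\nabla_u f_i(u,v_i)$, $\mathbb{E}[\nabla_v F(u,v_i;\xi_i)]=\nabla_v f_i(u,v_i)$, $\mathbb{E}\|\nabla_u F(u,v_i;\xi_i)-\nabla_u f_i(u,v_i)\|^2\le\sigma_u^2$ and $\mathbb{E}\|\nabla_v F(u,v_i;\xi_i)-\nabla_v f_i(u,v_i)\|^2\le\sigma_v^2$. (Bounded gradient dissimilarity) there is $b>0$ such that $\frac1n\sum_{i=1}^n\|\nabla_u f_i(u,v_i)\|^2\le b^2+\|\nabla_u f(u,\mathbf v)\|^2$ for all $u,\mathbf v$. Run FedAvg-P for $T$ rounds with $\eta_u\ge\sqrt m$, $\eta_v\ge\sqrt{n/m}$ and $\gamma\le\frac{1}{32LK}$, where $\gamma=\gamma_u\eta_u=\gamma_v\eta_v$. Then $$\frac1T\sum_{t=0}^{T-1}\big(\mathcal G_u^t+\hat{\mathcal G}_{\mathbf v}^t\big)\le\frac{4F_0}{TK\gamma}+12L\Big(\frac{4(n-m)Kb^2}{mn}+\frac{\sigma_u^2}{m}+\frac{m\sigma_v^2}{n}\Big)\gamma+\frac{128L^2K(K-1)b^2}{\eta_u^2}\gamma^2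 .$$
   Context: Problem: $n$ clients, shared variable $u\in\mathbb R^{d_u}$, personal variables $\mathbf v=[v_1;\dots;v_n]$, $v_i\in\mathbb R^{d_v}$; $f_i(u,v_i)=\mathbb E_{\xi_i\sim\mathcal D_i}[F(u,v_i;\xi_i)]$ and $f(u,\mathbf v)=\frac1n\sum_{i=1}^n f_i(u,v_i)$. $\nabla_u,\nabla_v$ are the partial gradients in the first and second argument; $\|\cdot\|$ is Euclidean. FedAvg-P algorithm: parameters $T\ge1$ rounds, $K\ge1$ local steps, $1\le m\le n$, step sizes $\gamma_u,\gamma_v,\eta_u,\eta_v>0$ satisfying $\gamma_u\eta_u=\gamma_v\eta_v=:\gamma$; deterministic initial point $(u^0,\mathbf v^0)$. In each round $t=0,\dots,T-1$: draw $\mathcal S^t\subset\{1,\dots,n\}$ uniformly at random among subsets of size $m$. Each $i\in\mathcal S^t$ sets $u_{i,0}^t=u^t$, $v_{i,0}^t=v_i^t$, and for $k=0,\dots,K-1$ performs $u_{i,k+1}^t=u_{i,k}^t-\gamma_u\nabla_uF(u_{i,k}^t,v_{i,k}^t;\xi_{i,k}^t)$, $v_{i,k+1}^t=v_{i,k}^t-\gamma_v\nabla_vF(u_{i,k}^t,v_{i,k}^t;\xi_{i,k}^t)$, with $\xi_{i,k}^t\sim\mathcal D_i$; then $v_i^{t+1}=(1-\eta_v)v_i^t+\eta_v v_{i,K}^t$. For $i\notin\mathcal S^t$, $v_i^{t+1}=v_i^t$. Finally $u^{t+1}=(1-\eta_u)u^t+\frac{\eta_u}{m}\sum_{i\in\mathcal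 S^t}u_{i,K}^t$. All samples $\xi_{i,k}^t$ and all sets $\mathcal S^t$ are mutually independent. Notation: $\mathcal G_u^t=\mathbb E\|\nabla_uf(u^t,\mathbf v^t)\|^2$, $\hat{\mathcal G}_{\mathbf v}^t=\frac{m}{n^2}\sum_{i=1}^n\mathbb E\|\nabla_vf_i(u^t,v_i^t)\|^2$, $F_0=f(u^0,\mathbf v^0)-\inf_{u,\mathbf v}f(u,\mathbf v)$. Assume $L>0$. *)

(* Defs.v *)
From HB Require Import structures.
From mathcomp Require Import all_boot all_order all_algebra.
From mathcomp Require Import all_classical all_reals all_analysis.

Set Implicit Arguments.
Unset Strict Implicit.
Unset Printing Implicit Defensive.

Import Order.TTheory GRing.Theory Num.Theory.
Import numFieldNormedType.Exports.

Local Open Scope classical_set_scope.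
Local Open Scope ring_scope.

Section Euclidean.
Context {R : realType}.

(* The canonical norm `|u| on row vectors is the sup norm, so the Euclidean
   one is defined here.  The topology, hence [differentiable], is the same. *)
Definition enorm d (u : 'rV[R]_d) : R := Num.sqrt (\sum_j u 0 j ^+ 2).

Definition grad d (g : 'rV[R]_d -> R) (u : 'rV[R]_d) : 'rV[R]_d :=
  \row_j 'D_(delta_mx 0 j) g u.

Definition grad_fst du dv (g : 'rV[R]_du -> 'rV[R]_dv -> R) u v : 'rV[R]_du :=
  grad (fun u' => g u' v) u.

Definition grad_snd du dv (g : 'rV[R]_du -> 'rV[R]_dv -> R) u v : 'rV[R]_dv :=
  grad (fun v' => g u v') v.

Definition partially_differentiable du dv
    (g : 'rV[R]_du -> 'rV[R]_dv -> R) : Prop :=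
  forall u v, differentiable (fun u' => g u' v) u /\
              differentiable (fun v' => g u v') v.

End Euclidean.

Section Independence.
Context {R : realType} {d : measure_display} {Omega : measurableType d}.

(* Independence of a finite family of classes of events; applied to the
   sigma-algebras generated by random elements it is their mutual
   independence, even when they take values in different spaces. *)
Definition mutually_independent (P : probability Omega R) (I : finType)
    (G : I -> set (set Omega)) : Prop :=
  forall (J : {set I}) (E : I -> set Omega),
    (forall j, j \in J -> G j (E j)) ->
    (P (\bigcap_(j in [set` J]) E j) = \prod_(j in J) P (E j))%E.

End Independence.

Section Problem.
Context {R : realType} {dXi : measure_display} {Xi : measurableType dXi}.
Context {du dv n : nat}.
Variables (F : 'rV[R]_du -> 'rV[R]_dv -> Xi -> R).
Variables (D : 'I_n -> probability Xi R).

Definition stoch_grad_u u v x : 'rV[R]_du := grad_fst (fun u v => F u v x) u v.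
Definition stoch_grad_v u v x : 'rV[R]_dv := grad_snd (fun u v => F u v x) u v.

Definition local_loss (i : 'I_n) (u : 'rV[R]_du) (v : 'rV[R]_dv) : R :=
  fine 'E_(D i)[F u v].

Definition loss (u : 'rV[R]_du) (v : 'I_n -> 'rV[R]_dv) : R :=
  n%:R^-1 * \sum_i local_loss i u (v i).

Definition loss_grad_u u (v : 'I_n -> 'rV[R]_dv) : 'rV[R]_du :=
  grad (fun u' => loss u' v) u.

(* Extended-real, so that it is +oo when the loss is not bounded below. *)
Definition optimality_gap u0 v0 : \bar R :=
  ((loss u0 v0)%:E - ereal_inf
     (range (fun w : 'rV[R]_du * ('I_n -> 'rV[R]_dv) => (loss w.1 w.2)%:E)))%E.

Definition smoothness (Lu Luv Lv Lvu : R) : Prop :=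
  forall i,
  [/\ partially_differentiable (local_loss i),
      forall u u' v,
        enorm (grad_fst (local_loss i) u v - grad_fst (local_loss i) u' v)
          <= Lu * enorm (u - u'),
      forall u v v',
        enorm (grad_fst (local_loss i) u v - grad_fst (local_loss i) u v')
          <= Luv * enorm (v - v'),
      forall u v v',
        enorm (grad_snd (local_loss i) u v - grad_snd (local_loss i) u v')
          <= Lv * enorm (v - v') &
      forall u u' v,
        enorm (grad_snd (local_loss i) u v - grad_snd (local_loss i) u' v)
          <= Lvu * enorm (u - u')].

(* The expectation of a random vector is taken coordinatewise. *)
Definition unbiased_gradients : Prop :=
  forall i u v,
    (forall j, 'E_(D i)[fun x => (stoch_grad_u u v x 0 j)%R]%E
               = (grad_fst (local_loss i) u v 0 j)%:E) /\
    (forall j, 'E_(D i)[fun x => (stoch_grad_v u v x 0 j)%R]%E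
               = (grad_snd (local_loss i) u v 0 j)%:E).

Definition bounded_variance (sigma_u sigma_v : R) : Prop :=
  forall i u v,
    ('E_(D i)[fun x => (enorm (stoch_grad_u u v x
                               - grad_fst (local_loss i) u v) ^+ 2)%R]
       <= (sigma_u ^+ 2)%:E)%E /\
    ('E_(D i)[fun x => (enorm (stoch_grad_v u v x
                               - grad_snd (local_loss i) u v) ^+ 2)%R]
       <= (sigma_v ^+ 2)%:E)%E.

Definition bounded_dissimilarity (b : R) : Prop :=
  forall u (v : 'I_n -> 'rV[R]_dv),
    n%:R^-1 * \sum_i enorm (grad_fst (local_loss i) u (v i)) ^+ 2
      <= b ^+ 2 + enorm (loss_grad_u u v) ^+ 2.

End Problem.

Section FedAvgP.
Context {R : realType} {dXi : measure_display} {Xi : measurableType dXi}.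
Context {du dv n : nat}.
Variables (F : 'rV[R]_du -> 'rV[R]_dv -> Xi -> R).
Variables (m K : nat) (gamma_u gamma_v eta_u eta_v : R).

Fixpoint local_iter (x : nat -> Xi) (p : 'rV[R]_du * 'rV[R]_dv) (k : nat)
    : 'rV[R]_du * 'rV[R]_dv :=
  if k is k'.+1 then
    let q := local_iter x p k' in
    (q.1 - gamma_u *: stoch_grad_u F q.1 q.2 (x k'),
     q.2 - gamma_v *: stoch_grad_v F q.1 q.2 (x k'))
  else p.

Definition fedavgp_round (A : {set 'I_n}) (x : 'I_n -> nat -> Xi)
    (w : 'rV[R]_du * ('I_n -> 'rV[R]_dv))
    : 'rV[R]_du * ('I_n -> 'rV[R]_dv) :=
  let loc i := local_iter (x i) (w.1, w.2 i) K in
  ((1 - eta_u) *: w.1 + (eta_u / m%:R) *: \sum_(i in A) (loc i).1,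
   fun i => if i \in A then (1 - eta_v) *: w.2 i + eta_v *: (loc i).2
            else w.2 i).

(* [Sel t] and [x t i k] are the client set of round t and the sample of
   client i at its k-th local step of round t. *)
Fixpoint fedavgp (Sel : nat -> {set 'I_n}) (x : nat -> 'I_n -> nat -> Xi)
    (w0 : 'rV[R]_du * ('I_n -> 'rV[R]_dv)) (t : nat)
    : 'rV[R]_du * ('I_n -> 'rV[R]_dv) :=
  if t is t'.+1 then fedavgp_round (Sel t') (x t') (fedavgp Sel x w0 t') else w0.

End FedAvgP.

Section Sampling.
Context {R : realType} {d dXi : measure_display}.
Context {Omega : measurableType d} {Xi : measurableType dXi} {n : nat}.
Variables (P : probability Omega R) (D : 'I_n -> probability Xi R).
Variables (T K m : nat).
Variables (Sel : nat -> Omega -> {set 'I_n}).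
Variables (xi : nat -> 'I_n -> nat -> {RV P >-> Xi}).

Definition uniform_client_sampling : Prop :=
  forall t, (t < T)%N -> forall A : {set 'I_n},
    measurable (Sel t @^-1` [set A]) /\
    P (Sel t @^-1` [set A]) = (if #|A| == m then 'C(n, m)%:R^-1 else 0)%:E.

Definition sample_laws : Prop :=
  forall t i k, (t < T)%N -> (k < K)%N ->
    forall B, measurable B -> distribution P (xi t i k) B = D i B.

(* Every subset of the finite type of client sets counts as measurable. *)
Definition draw_sigma (j : 'I_T + 'I_T * 'I_n * 'I_K) : set (set Omega) :=
  match j with
  | inl t => preimage_set_system setT (Sel t) setT
  | inr (t, i, k) => preimage_set_system setT (xi t i k) measurable
  end.

Definition fedavgp_draws : Prop :=
  [/\ uniform_client_sampling, sample_laws &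
      mutually_independent P draw_sigma].

End Sampling.

(* Main.v *)
Require Import Defs.
From HB Require Import structures.
From mathcomp Require Import all_boot all_order all_algebra.
From mathcomp Require Import all_classical all_reals all_analysis.
From mathcomp Require Import measurable_realfun ring lra.
Import Order.TTheory GRing.Theory Num.Theory.
Import numFieldNormedType.Exports.
Local Open Scope classical_set_scope.
Local Open Scope ring_scope.

(** A round is analysed pathwise, for each fixed set [A] of participating
    clients.  The descent lemma bounds the decrease of the loss by a quadratic
    function of the update, and the update splits into the gradients at the
    start of the round, the errors due to client drift, and partial sums of the
    gradient noise.  Averaging over the subsets [A] of size [m] (whose first two
    moments are explicit) and bounding the drift by the initial gradients and the
    noise leaves [- gamma K / 4] times the squared gradient norms, plus
    dissimilarity terms, plus linear and quadratic expressions in the noise sums.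

    Each noise increment is centred given all draws that precede it or belong to
    other clients of the same round: these draws generate a sigma-algebra
    independent of the current sample, so Fubini applies to the product law.
    Hence the linear terms vanish in expectation and the noise increments are
    orthogonal, which gives the variances [K sigma_u^2 / m] and [K sigma_v^2].
    Replacing the selected set by the average over [A] is justified by its
    independence of everything else in the round.  The losses are telescoped
    pathwise, and only the quadratic majorants are integrated, so the loss along
    the run need not be integrable. *)

Set Implicit Arguments.
Unset Strict Implicit.
Unset Printing Implicit Defensive.

(** * Independence and Fubini *)

(** Two obstacles shape the development. First, the noise of a local step is evaluated at a random
    iterate, whereas [F] is only measurable in the sample for fixed arguments and differentiable in
    each argument separately. Joint measurability therefore has to be built, and square
    integrability of every iterate is proved by induction along the run before any expectation is
    split. Second, the local runs are defined for all clients, selected or not; for a prescribed set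
    the whole round is then a function of draws independent of the actual selection.

    The constants come from x = gamma L K <= 1/32. The initial gradients give a decrease gamma K;
    Young's inequality for the drift errors takes half of it, and the quadratic and drift terms, of
    relative size 4x and 20x^2, leave more than 1/4. The lower bounds on [eta_u] and [eta_v] say
    that gamma_u^2 <= gamma^2 / m and gamma_v^2 <= gamma^2 m / n. So the noise carried by the drift
    has the same factors sigma_u^2 / m and m sigma_v^2 / n as the direct variance, and is smaller by
    a multiple of x. *)

Section IndependentSystems.
Context {R : realType} {d : measure_display} {Omega : measurableType d}.
Variable P : probability Omega R.

Definition indep_systems (C C' : set (set Omega)) : Prop :=
  forall A B, C A -> C' B -> P (A `&` B) = (P A * P B)%E.

Variables (I : finType) (G : I -> set (set Omega)).
Hypothesis G_measurable : forall i, G i `<=` measurable.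
Hypothesis G_setT : forall i, G i setT.
Hypothesis G_setI : forall i, setI_closed (G i).

Definition joint_system (J : {set I}) : set (set Omega) :=
  \bigcup_(i in [set` J]) G i.

Let rectangles (J : {set I}) : set (set Omega) :=
  [set \bigcap_(i in [set` J]) E i | E in [set E | forall i, G i (E i)]].

Lemma joint_system_measurable (J : {set I}) : joint_system J `<=` measurable.
Proof. by move=> A [i _]; exact: G_measurable. Qed.

(** A pi-system argument. For fixed [B] in [G j], the finite measures sending [A] to the probability
    of its intersection with [B] and to [P B * P A] agree on the rectangles over [J], by
    independence over [j |: J]. Rectangles are stable under intersection and, as each [G i] contains
    [setT], they include every generator of the joint sigma-algebra. *)
Lemma mutually_independent_joint_system (J : {set I}) (j : I) :
  mutually_independent P G -> j \notin J ->
  indep_systems <<s joint_system J >> (G j).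
Proof.
move=> indG jJ A B GA GB.
have mB := G_measurable GB.
have rectP E : (forall i, G i (E i)) ->
    P (\bigcap_(i in [set` J]) E i `&` B) =
    (P (\bigcap_(i in [set` J]) E i) * P B)%E.
  move=> GE; rewrite indG//.
  pose E' i := if i == j then B else E i.
  have -> : \bigcap_(i in [set` J]) E i `&` B =
      \bigcap_(i in [set` j |: J]) E' i.
    rewrite eqEsubset; split => w.
      move=> [Ew Bw] i /=; rewrite !inE /E' => /orP[/eqP ->|iJ].
        by rewrite eqxx.
      by case: eqP => // _; exact: Ew.
    move=> Ew; split.
      move=> i /= iJ; have := Ew i; rewrite /= /E' !inE iJ orbT => /(_ isT).
      by case: eqP => // ij; rewrite -ij iJ in jJ.
    by have := Ew j; rewrite /= /E' !inE eqxx => /(_ isT).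
  rewrite indG; last by move=> i _; rewrite /E'; case: eqP => // ->.
  rewrite big_setU1//= /E' eqxx muleC; congr (_ * _)%E.
  by apply: eq_bigr => i iJ; case: eqP => // ij; rewrite -ij iJ in jJ.
have p0 : 0 <= fine (P B) by rewrite fine_ge0.
pose m1 : {measure set Omega -> \bar R} := mrestr P mB.
pose m2 : {measure set Omega -> \bar R} := mscale (NngNum p0) P.
have := @g_sigma_algebra_measure_unique _ _ _ (rectangles J) _ (fun=> setT)
  _ _ m1 m2 _ _ _ A.
have cvr : \bigcup_(k : nat) (setT : set Omega) = setT.
  by rewrite -subTset => w _; exists 0%N.
have PBfin : P B \is a fin_num by exact: fin_num_measure.
move=> /(_ _ _ cvr) H; suff : m1 A = m2 A.
  by rewrite /m1 /m2 /= /mrestr /mscale /= fineK// muleC.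
apply: H.
- move=> _ [E GE <-]; apply: fin_bigcap_measurable => // i _.
  exact: G_measurable (GE i).
- by move=> _; exists (fun=> setT) => //; exact: bigcapT.
- move=> _ _ [E GE <-] [E' GE' <-]; exists (fun i => E i `&` E' i).
    by move=> i; exact: G_setI.
  by rewrite bigcapI.
- move=> _ [E GE <-].
  by rewrite /m1 /m2 /= /mrestr /mscale /= fineK// muleC rectP.
- move=> _; rewrite /m1 /= /mrestr setTI.
  by rewrite ltey_eq PBfin.
- move: GA; apply: sub_smallest2r => // {A}A [i iJ GA].
  exists (fun i' => if i' == i then A else setT).
    by move=> i' /=; case: eqP => // ->.
  rewrite eqEsubset; split => w.
    by move=> /(_ i iJ); rewrite eqxx.
  by move=> Aw i' _; case: eqP.
Qed.

End IndependentSystems.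

Section IndependentFubini.
Local Open Scope ereal_scope.
Context {R : realType} {d d2 : measure_display}.
Context {Omega : measurableType d} {S : measurableType d2}.
Variables (P : probability Omega R) (C : set (set Omega)).
Hypothesis C_measurable : C `<=` measurable.
Variables (X : {mfun Omega >-> S}) (mu : probability S R).
Hypothesis X_indep : forall A B, <<s C >> A -> measurable B ->
  P (A `&` X @^-1` B) = P A * mu B.

Local Notation T1 := (g_sigma_algebraType C).

(** The identity is viewed as a random element of [Omega] with the coarser sigma-algebra: it stands
    for the whole history at once. Independence then says that the pair [XC] has a product law. *)
Let idC : Omega -> T1 := id.

Let measurable_idC : measurable_fun setT idC.
Proof.
move=> _ A mA; rewrite setTI.
by apply: (smallest_sub (@sigma_algebra_measurable _ Omega) C_measurable).
Qed.

Let XC (w : Omega) : T1 * S := (idC w, X w).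

Let measurable_XC : measurable_fun setT XC.
Proof. exact: measurable_fun_pair. Qed.

HB.instance Definition _ := isMeasurableFun.Build _ _ _ _ idC measurable_idC.
HB.instance Definition _ := isMeasurableFun.Build _ _ _ _ XC measurable_XC.

Let P1 := distribution P idC.

Let joint_law A : measurable A -> (P1 \x mu) A = distribution P XC A.
Proof.
by move=> mA; apply: product_measure_unique => // B1 B2 mB1; exact: X_indep.
Qed.

Lemma indep_ge0_integral_le (h : (T1 * S)%type -> \bar R) (c : \bar R) :
  measurable_fun [set: (T1 * S)%type] h -> (forall z, 0 <= h z) ->
  (forall w, \int[mu]_x h (w, x) <= c) ->
  \int[P]_w h (w, X w) <= c.
Proof.
move=> mh h0 hc.
have -> : \int[P]_w h (w, X w) = \int[distribution P XC]_z h z.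
  by rewrite ge0_integral_distribution.
rewrite (eq_measure_integral (P1 \x mu)); last first.
  by move=> A mA _; exact/esym/joint_law.
rewrite fubini_tonelli1//.
have c0 : 0 <= c by apply: le_trans (hc point); exact: integral_ge0.
apply: (@le_trans _ _ (\int[P1]_x (cst c) x)).
  apply: ge0_le_integral => //.
  - by move=> w _; apply: integral_ge0.
  - exact: measurable_fun_fubini_tonelli_F.
  by move=> w _; exact: hc.
rewrite integral_cst//= [X in c * X](_ : _ = 1) ?mule1//.
exact: probability_setT.
Qed.

(** Signed version of the freezing argument. Fubini needs integrability under the product law, which
    is transported from integrability under [P] through the law of the pair. *)
Lemma indep_integral_eq0 (h : (T1 * S)%type -> \bar R) :
  measurable_fun [set: (T1 * S)%type] h ->
  P.-integrable setT (fun w => h (w, X w)) ->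
  (forall w, \int[mu]_x h (w, x) = 0) ->
  \int[P]_w h (w, X w) = 0.
Proof.
move=> mh hi h0.
have hi' : (distribution P XC).-integrable setT h.
  by apply: integrable_pushforward => //; exact: measurable_XC.
have -> : \int[P]_w h (w, X w) = \int[distribution P XC]_z h z.
  by rewrite integral_distribution.
rewrite (eq_measure_integral (P1 \x mu)); last first.
  by move=> A mA _; exact/esym/joint_law.
rewrite -integral12_prod_meas1//.
  by rewrite (eq_integral (cst 0)) ?integral0// => w _; exact: h0.
apply/integrableP; split => //.
rewrite (eq_measure_integral (distribution P XC)); last first.
  by move=> A mA _; exact: joint_law.
by have /integrableP[] := hi'.
Qed.

End IndependentFubini.

(** * Measurability of separately continuous integrands *)

Section Caratheodory.
Context {R : realType} {dT : measure_display} {T : measurableType dT}.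

Definition coord_measurable d (U : T -> 'rV[R]_d) : Prop :=
  forall j, measurable_fun setT (fun t => U t 0 j).

(* Grid roundings have countably many values and converge to the identity, so a
   Caratheodory integrand along [U] is a limit of measurable functions. *)
Let round d (k : nat) (u : 'rV[R]_d) : 'rV[R]_d :=
  \row_j ((Num.floor (u 0 j * k.+1%:R))%:~R / k.+1%:R).

Let cvg_round d (u : 'rV[R]_d) : round k u @[k --> \oo] --> u.
Proof.
apply/cvgrPdist_lt => e e0.
have := @near_infty_natSinv_lt R (PosNum e0); apply: filterS => k /= ke.
rewrite /Num.norm /= mx_normrE; apply/bigmax_ltP; split => // -[i j] _ /=.
rewrite !mxE ord1; apply: le_lt_trans ke.
have k0 : 0 < k.+1%:R :> R by [].
have -> : u 0 j - (Num.floor (u 0 j * k.+1%:R))%:~R / k.+1%:R =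
    (u 0 j * k.+1%:R - (Num.floor (u 0 j * k.+1%:R))%:~R) / k.+1%:R.
  by rewrite mulrBl mulfK// lt0r_neq0.
have /andP[h1 h2] := floor_itv (u 0 j * k.+1%:R).
rewrite normrM normfV (ger0_norm (ltW k0)) ger0_norm ?subr_ge0//.
rewrite -[leRHS]mul1r ler_wpM2r ?invr_ge0// ?ltW//.
by rewrite ltrBlDl -[1]/(1%:~R) -intrD.
Qed.

Lemma measurable_caratheodory d (g : 'rV[R]_d -> T -> R) (U : T -> 'rV[R]_d) :
  (forall t, continuous (g^~ t)) -> (forall u, measurable_fun setT (g u)) ->
  coord_measurable U -> measurable_fun setT (fun t => g (U t) t).
Proof.
move=> gc gm mU.
apply: (measurable_fun_cvg (h := fun k t => g (round k (U t)) t)); last first.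
  by move=> t _; exact: (cvg_comp _ _ (@cvg_round d (U t)) (gc t (U t))).
move=> k _ B mB; rewrite setTI.
(* On [cell z] the rounded argument is the constant [value z]; the preimage of [B] is thus a
   countable union over integer vectors of sets that involve [g] at fixed points only. *)
pose cell (z : 'rV[int]_d) :=
  [set t | forall j, Num.floor (U t 0 j * k.+1%:R) = z 0 j].
pose value (z : 'rV[int]_d) : 'rV[R]_d := \row_j ((z 0 j)%:~R / k.+1%:R).
rewrite (_ : _ @^-1` _ = \bigcup_z (cell z `&` g (value z) @^-1` B)).
  apply: countable_bigcupT_measurable; first exact: countableP.
  move=> z; apply: measurableI; last by rewrite -[X in measurable X]setTI; exact: gm.
  rewrite (_ : cell z = \bigcap_(j in [set: 'I_d])
      ((fun t => U t 0 j * k.+1%:R) @^-1` `[(z 0 j)%:~R, (z 0 j + 1)%:~R[)).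
    apply: fin_bigcap_measurable => // j _.
    rewrite -[X in measurable X]setTI.
    by apply: measurable_funM => //; exact: mU.
  rewrite eqEsubset; split => t /= tz j.
    by move=> _ /=; rewrite in_itv /= -floor_eq tz.
  by have := tz j I; rewrite /= in_itv /= -floor_eq => /eqP.
rewrite eqEsubset; split => t /=.
  move=> Bt; exists (\row_j Num.floor (U t 0 j * k.+1%:R)) => //=.
  split; first by move=> j; rewrite mxE.
  by rewrite (_ : value _ = round k (U t))//; apply/rowP => j; rewrite !mxE.
move=> [z _ [tz]]; rewrite (_ : value z = round k (U t))//.
by apply/rowP => j; rewrite !mxE tz.
Qed.

(** Separate continuity suffices: once [V] is substituted, the integrand is still measurable for
    each fixed [u] and continuous in [u], so the one-variable case applies again. *)
Lemma measurable_caratheodory2 d d' (g : 'rV[R]_d -> 'rV[R]_d' -> T -> R)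
    (U : T -> 'rV[R]_d) (V : T -> 'rV[R]_d') :
  (forall v t, continuous (fun u => g u v t)) ->
  (forall u t, continuous (fun v => g u v t)) ->
  (forall u v, measurable_fun setT (g u v)) ->
  coord_measurable U -> coord_measurable V ->
  measurable_fun setT (fun t => g (U t) (V t) t).
Proof.
move=> gu gv gm mU mV.
apply: (measurable_caratheodory (g := fun u t => g u (V t) t)) => // u.
by apply: (measurable_caratheodory (g := fun v t => g u v t)).
Qed.

End Caratheodory.

Section DerivativeSequence.
Context {R : realType}.

(** A derivative as a limit along a sequence, the form in which a limit of measurable functions is
    measurable. *)
Lemma cvg_diff_quotient (V : normedModType R) (f : V -> R) (a v : V) :
  derivable f a v ->
  (k.+1%:R^-1)^-1 *: (f (k.+1%:R^-1 *: v + a) - f a) @[k --> \oo] --> 'D_v f a.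
Proof.
move=> fav; have /cvgr_dnbhsP := fav => /(_ (fun k => k.+1%:R^-1)); apply.
split; first by move=> k; rewrite invr_neq0.
exact: cvg_harmonic.
Qed.

End DerivativeSequence.

(** * Euclidean geometry and the descent lemma *)

Section InnerProduct.
Context {R : realType} {d : nat}.
Implicit Types (u v w : 'rV[R]_d) (a c : R).

Definition dot u v : R := \sum_j u 0 j * v 0 j.

Definition sq u : R := dot u u.

Lemma enorm_sqr u : enorm u ^+ 2 = sq u.
Proof.
rewrite /enorm sqr_sqrtr; last by apply: sumr_ge0 => j _; exact: sqr_ge0.
by apply: eq_bigr => j _; rewrite expr2.
Qed.

Lemma enorm_ge0 u : 0 <= enorm u.
Proof. exact: sqrtr_ge0. Qed.

Lemma sq_ge0 u : 0 <= sq u.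
Proof. by rewrite -enorm_sqr sqr_ge0. Qed.

Lemma dotC u v : dot u v = dot v u.
Proof. by apply: eq_bigr => j _; rewrite mulrC. Qed.

Lemma dotDl u v w : dot (u + v) w = dot u w + dot v w.
Proof. by rewrite -big_split; apply: eq_bigr => j _; rewrite mxE mulrDl. Qed.

Lemma dotDr u v w : dot u (v + w) = dot u v + dot u w.
Proof. by rewrite dotC dotDl !(dotC u). Qed.

Lemma dotZl a u v : dot (a *: u) v = a * dot u v.
Proof. by rewrite mulr_sumr; apply: eq_bigr => j _; rewrite mxE mulrA. Qed.

Lemma dotZr a u v : dot u (a *: v) = a * dot u v.
Proof. by rewrite dotC dotZl dotC. Qed.

Lemma dotNl u v : dot (- u) v = - dot u v.
Proof. by rewrite -scaleN1r dotZl mulN1r. Qed.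

Lemma dotNr u v : dot u (- v) = - dot u v.
Proof. by rewrite dotC dotNl dotC. Qed.

Lemma dot0l v : dot 0 v = 0.
Proof. by rewrite -(scale0r 0) dotZl mul0r. Qed.

Lemma dot0r v : dot v 0 = 0.
Proof. by rewrite dotC dot0l. Qed.

Lemma dot_suml (I : Type) (r : seq I) (Q : pred I) (F : I -> 'rV[R]_d) v :
  dot (\sum_(i <- r | Q i) F i) v = \sum_(i <- r | Q i) dot (F i) v.
Proof.
elim/big_rec2: _ => [|i x y _ <-]; [exact: dot0l|exact: dotDl].
Qed.

Lemma dot_sumr (I : Type) (r : seq I) (Q : pred I) (F : I -> 'rV[R]_d) v :
  dot v (\sum_(i <- r | Q i) F i) = \sum_(i <- r | Q i) dot v (F i).
Proof. by rewrite dotC dot_suml; apply: eq_bigr => i _; rewrite dotC. Qed.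

Lemma sqD u v : sq (u + v) = sq u + 2 * dot u v + sq v.
Proof. by rewrite /sq dotDl !dotDr (dotC v u); ring. Qed.

Lemma sqZ a u : sq (a *: u) = a ^+ 2 * sq u.
Proof. by rewrite /sq dotZl dotZr mulrA -expr2. Qed.

Lemma sqN u : sq (- u) = sq u.
Proof. by rewrite /sq dotNl dotNr opprK. Qed.

Lemma sq0 : sq (0 : 'rV[R]_d) = 0.
Proof. exact: dot0l. Qed.

Lemma sqB u v : sq (u - v) = sq u - 2 * dot u v + sq v.
Proof. by rewrite sqD dotNr sqN mulrN. Qed.

Lemma dot_young c u v : 0 < c -> dot u v <= c / 2 * sq u + (2 * c)^-1 * sq v.
Proof.
move=> c0; have := sq_ge0 (c *: u - v).
rewrite sqB sqZ dotZl => h.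
have {h} : 0 <= (2 * c)^-1 * (c ^+ 2 * sq u - 2 * (c * dot u v) + sq v).
  by rewrite mulr_ge0// invr_ge0 mulr_ge0// ltW.
suff -> : (2 * c)^-1 * (c ^+ 2 * sq u - 2 * (c * dot u v) + sq v) =
  c / 2 * sq u + (2 * c)^-1 * sq v - dot u v by rewrite subr_ge0.
by field; rewrite gt_eqF.
Qed.

Lemma sqD_le u v : sq (u + v) <= 2 * sq u + 2 * sq v.
Proof. by have := sq_ge0 (u - v); rewrite sqB sqD; lra. Qed.

(** The sum over all pairs of the squared differences is nonnegative, and it equals twice the gap
    between the two sides. *)
Lemma sq_sum_le (I : finType) (Q : pred I) (F : I -> 'rV[R]_d) :
  sq (\sum_(i | Q i) F i) <= #|Q|%:R * \sum_(i | Q i) sq (F i).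
Proof.
have : 0 <= \sum_(i | Q i) \sum_(j | Q j) sq (F i - F j).
  by apply: sumr_ge0 => i _; apply: sumr_ge0 => j _; exact: sq_ge0.
set S := \sum_(i | Q i) F i; set N := #|Q|%:R; set q := \sum_(i | Q i) sq (F i).
suff -> : \sum_(i | Q i) \sum_(j | Q j) sq (F i - F j) =
  N * q - 2 * sq S + N * q by move=> h; lra.
transitivity (\sum_(i | Q i) (N * sq (F i) - 2 * dot (F i) S + q)).
  apply: eq_bigr => i _.
  under eq_bigr do rewrite sqB.
  rewrite big_split /= sumrB sumr_const -mulr_sumr -dot_sumr -/S -/q.
  by rewrite -[_ *+ #|_|]mulr_natl.
rewrite big_split /= sumrB sumr_const -!mulr_sumr -dot_suml -/(sq S) -/q.
by rewrite -[_ *+ #|_|]mulr_natl.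
Qed.

End InnerProduct.

Section Gradient.
Context {R : realType} {d : nat}.
Implicit Types (g : 'rV[R]_d -> R) (u v : 'rV[R]_d) (L : R).

Lemma derive_grad g u v : differentiable g u -> 'D_v g u = dot (grad g u) v.
Proof.
move=> dg; rewrite deriveE// {1}(row_sum_delta v) linear_sum.
apply: eq_bigr => j _.
by rewrite linearZ /= mxE -deriveE// mulrC.
Qed.

Let derive_line g u v (s : R) : differentiable g (u + s *: v) ->
  is_derive s 1 (fun s : R => g (u + s *: v)) (dot (grad g (u + s *: v)) v).
Proof.
move=> dg; rewrite -derive_grad//.
have e : (fun h : R => h^-1 *: (((fun s : R => g (u + s *: v)) \o shift s) (h *: 1)
      - g (u + s *: v))) =
    (fun h : R => h^-1 *: ((g \o shift (u + s *: v)) (h *: v) - g (u + s *: v))).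
  apply/funext => h /=; congr (_ *: (g _ - _)).
  by rewrite [h *: 1]mulr1 scalerDl addrCA addrA addrC.
have /= dgv := @diff_derivable _ _ _ _ _ v dg.
by apply: DeriveDef; rewrite /derivable /derive e.
Qed.

(** The mean value theorem replaces integration of the gradient along the segment: [phi] is [g] on
    the segment minus its linear part and the quadratic correction, its derivative is nonpositive,
    and phi 1 <= phi 0 is the claim. *)
Lemma descent_lemma g L u u' : 0 < L -> (forall w, differentiable g w) ->
  (forall w w', sq (grad g w - grad g w') <= L ^+ 2 * sq (w - w')) ->
  g u' <= g u + dot (grad g u) (u' - u) + L / 2 * sq (u' - u).
Proof.
move=> L0 dg Lg; set v := u' - u.
pose a := dot (grad g u) v; pose c := L / 2 * sq v.
pose phi : R -> R := (fun s : R => g (u + s *: v))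
  + ((- a) \*: (id : R -> R) + (- c) \*: ((id : R -> R) ^+ 2)).
pose dphi (s : R) := dot (grad g (u + s *: v)) v - a - L * s * sq v.
have dphiP (s : R) : is_derive s (1 : R) phi (dphi s).
  have dp : is_derive s (1 : R)
      ((- a) \*: (id : R -> R) + (- c) \*: ((id : R -> R) ^+ 2)) (- a - 2 * c * s).
    have d1 := is_deriveZ (- a) (is_derive_id s (1 : R)).
    have d2 := is_deriveZ (- c) (is_deriveX 2 (is_derive_id s (1 : R))).
    apply: is_derive_eq (is_deriveD d1 d2) _.
    by rewrite expr1 /GRing.scale /=; ring.
  apply: is_derive_eq (is_deriveD (derive_line (dg (u + s *: v))) dp) _.
  by rewrite /dphi /c; field.
have cphi : {within `[0, 1], continuous phi}.
  by apply: derivable_within_continuous => s _; have [] := dphiP s.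
have [s s01] := MVT ltr01 (fun s _ => dphiP s) cphi.
rewrite subr0 mulr1 /phi !fctE /= scale0r addr0 scale1r /v subrKC -/v.
have dphi0 : dphi s <= 0.
  move: s01; rewrite in_itv /= => /andP[s0 _].
  (* With weight L s in Young's inequality, both halves become (L s / 2) |v|^2. This recovers the
     Cauchy-Schwarz bound without taking square roots. *)
  have Ls0 : 0 < L * s by exact: mulr_gt0.
  have := dot_young v (grad g (u + s *: v) - grad g u) Ls0.
  have := Lg (u + s *: v) u; rewrite addrAC subrr add0r sqZ => h1.
  rewrite dotC dotDl dotNl -/a => h2.
  have h3 : (2 * (L * s))^-1 * sq (grad g (u + s *: v) - grad g u) <=
      (2 * (L * s))^-1 * (L ^+ 2 * (s ^+ 2 * sq v)).
    by rewrite ler_wpM2l// invr_ge0 mulr_ge0// ltW.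
  have h4 : (2 * (L * s))^-1 * (L ^+ 2 * (s ^+ 2 * sq v)) = L * s / 2 * sq v.
    by field; rewrite !gt_eqF.
  by rewrite /dphi; lra.
rewrite /a /c /GRing.scale /= => e.
by rewrite /GRing.exp /= ?mulr1 ?mulr0 in e; lra.
Qed.

End Gradient.

Lemma coord_sqr_le {R : realType} d (u : 'rV[R]_d) j : u 0 j ^+ 2 <= sq u.
Proof.
rewrite /sq /dot (bigD1 j)//= -expr2 lerDl.
by apply: sumr_ge0 => i _; exact: sqr_ge0.
Qed.

Lemma sq_continuous {R : realType} d : continuous (@sq R d).
Proof.
apply: continuous_big => [|j _]; first exact: add_continuous.
move=> u; have c := @coord_continuous R 1 d 0 j u; exact: (cvgM c c).
Qed.

(** Passes from a Euclidean Lipschitz bound to the topology of the canonical sup norm, through the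
    continuity of [sq]. *)
Lemma lipschitz_coord_continuous {R : realType} d d' (L : R)
    (g : 'rV[R]_d -> 'rV[R]_d') j :
  (forall u u', sq (g u - g u') <= L ^+ 2 * sq (u - u')) ->
  continuous (fun u => g u 0 j).
Proof.
move=> gL u; rewrite /continuous_at; 
  apply/(@cvgrPdist_lt R _ _ (nbhs u) (@nbhs_filter _ u)) => e e0.
pose h (w : 'rV[R]_d) : 'rV[R]_d := u - w.
have hc : {for u, continuous h}.
  by apply: continuousB; [exact: cst_continuous|move=> A; exact].
have : {for u, continuous (fun w => L ^+ 2 * sq (h w))}.
  apply: continuousM; first exact: cst_continuous.
  exact: (continuous_comp hc (@sq_continuous R d (h u))).
move=> /(@cvgrPdist_lt R _ _ (nbhs u) (@nbhs_filter _ u))/(_ (e ^+ 2)).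
rewrite [h u]subrr sq0 mulr0.
rewrite exprn_gt0// => /(_ isT); apply: filterS => u'.
rewrite sub0r normrN => uu'.
rewrite -(@ltr_pXn2r _ 2)// ?nnegrE ?ltW// real_normK ?num_real//.
apply: le_lt_trans uu'; apply: le_trans (ler_norm _).
by apply: le_trans (gL u u'); have := coord_sqr_le (g u - g u') j; rewrite !mxE.
Qed.

Lemma coord_measurable_lipschitz {R : realType} {dT} {T : measurableType dT}
    d d' d'' (L : R) (g : 'rV[R]_d -> 'rV[R]_d' -> 'rV[R]_d'')
    (U : T -> 'rV[R]_d) (V : T -> 'rV[R]_d') :
  (forall u u' v, sq (g u v - g u' v) <= L ^+ 2 * sq (u - u')) ->
  (forall u v v', sq (g u v - g u v') <= L ^+ 2 * sq (v - v')) ->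
  coord_measurable U -> coord_measurable V ->
  coord_measurable (fun t => g (U t) (V t)).
Proof.
move=> gu gv mU mV j.
apply: (measurable_caratheodory2 (g := fun u v _ => g u v 0 j)) => //.
- by move=> v t; apply: (lipschitz_coord_continuous (L := L) (g := g^~ v)) => u u'; exact: gu.
- by move=> u t; apply: (lipschitz_coord_continuous (L := L) (g := g u)) => v v'; exact: gv.
Qed.

(** * Stochastic gradients along random iterates *)

Section StochasticGradientMeasurable.
Context {R : realType} {dT dX : measure_display}.
Context {T : measurableType dT} {Xi : measurableType dX} {du dv : nat}.
Variables (F : 'rV[R]_du -> 'rV[R]_dv -> Xi -> R).
Hypothesis F_diff : forall x, partially_differentiable (fun u v => F u v x).
Hypothesis F_meas : forall u v, measurable_fun setT (F u v).
Variables (U : T -> 'rV[R]_du) (V : T -> 'rV[R]_dv) (X : T -> Xi).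
Hypotheses (mU : coord_measurable U) (mV : coord_measurable V).
Hypothesis mX : measurable_fun setT X.

Let measurable_F U' V' : coord_measurable U' -> coord_measurable V' ->
  measurable_fun setT (fun t : T => F (U' t) (V' t) (X t)).
Proof.
move=> mU' mV'.
apply: (measurable_caratheodory2 (g := fun u v t => F u v (X t))) => //.
- by move=> v t u; apply: differentiable_continuous; have [] := F_diff (X t) u v.
- by move=> u t v; apply: differentiable_continuous; have [] := F_diff (X t) u v.
- by move=> u v; exact: measurableT_comp.
Qed.

Let coord_measurable_shift d (U' : T -> 'rV[R]_d) (w : 'rV[R]_d) :
  coord_measurable U' -> coord_measurable (fun t => w + U' t).
Proof.
move=> mU' j.
under eq_fun do rewrite mxE.
exact: measurable_funD.
Qed.

(** No continuity of the stochastic gradient is available. Each of its coordinates is a limit of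
    difference quotients of [F], and [F] is separately continuous because it is partially
    differentiable. *)
Lemma coord_measurable_stoch_grad_u :
  coord_measurable (fun t => stoch_grad_u F (U t) (V t) (X t)).
Proof.
move=> j; under eq_fun do rewrite mxE.
apply: (measurable_fun_cvg (h := fun k t => (k.+1%:R^-1)^-1 *:
   (F (k.+1%:R^-1 *: delta_mx 0 j + U t) (V t) (X t) - F (U t) (V t) (X t)))).
  move=> k; apply: measurable_funM => //; apply: measurable_funB => //.
    by apply: measurable_F => //; exact: coord_measurable_shift.
  exact: measurable_F.
move=> t _; apply: cvg_diff_quotient; apply: diff_derivable.
by have [] := F_diff (X t) (U t) (V t).
Qed.

Lemma coord_measurable_stoch_grad_v :
  coord_measurable (fun t => stoch_grad_v F (U t) (V t) (X t)).
Proof.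
move=> j; under eq_fun do rewrite mxE.
apply: (measurable_fun_cvg (h := fun k t => (k.+1%:R^-1)^-1 *:
   (F (U t) (k.+1%:R^-1 *: delta_mx 0 j + V t) (X t) - F (U t) (V t) (X t)))).
  move=> k; apply: measurable_funM => //; apply: measurable_funB => //.
    by apply: measurable_F => //; exact: coord_measurable_shift.
  exact: measurable_F.
move=> t _; apply: cvg_diff_quotient; apply: diff_derivable.
by have [] := F_diff (X t) (U t) (V t).
Qed.

End StochasticGradientMeasurable.

(** * Consequences of smoothness for the losses *)

Section Smoothness.
Context {R : realType} {dXi : measure_display} {Xi : measurableType dXi}.
Context {n du dv : nat}.
Variables (D : 'I_n -> probability Xi R).
Variables (F : 'rV[R]_du -> 'rV[R]_dv -> Xi -> R).
Variables (Lu Luv Lv Lvu L : R).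
Hypothesis f_smooth : smoothness F D Lu Luv Lv Lvu.
Hypothesis L_def : L = Num.max (Num.max Lu Lv) (Num.max Luv Lvu).
Hypothesis L_gt0 : 0 < L.

Local Notation f := (local_loss F D).
Local Notation gu i := (grad_fst (f i)).
Local Notation gv i := (grad_snd (f i)).

Let sq_lipschitz d d' (C : R) (x : 'rV[R]_d) (y : 'rV[R]_d') :
  enorm x <= C * enorm y -> C <= L -> sq x <= L ^+ 2 * sq y.
Proof.
move=> h CL.
have Ly : 0 <= L * enorm y by rewrite mulr_ge0 ?enorm_ge0// ltW.
rewrite -!enorm_sqr -exprMn ler_pXn2r ?nnegrE ?enorm_ge0//.
by apply: le_trans h _; rewrite ler_wpM2r ?enorm_ge0.
Qed.

Lemma grad_fst_lipschitz_fst i u u' v :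
  sq (gu i u v - gu i u' v) <= L ^+ 2 * sq (u - u').
Proof.
have [_ h _ _ _] := f_smooth i; apply: sq_lipschitz (h u u' v) _.
by rewrite L_def !le_max lexx.
Qed.

Lemma grad_fst_lipschitz_snd i u v v' :
  sq (gu i u v - gu i u v') <= L ^+ 2 * sq (v - v').
Proof.
have [_ _ h _ _] := f_smooth i; apply: sq_lipschitz (h u v v') _.
by rewrite L_def !le_max lexx !orbT.
Qed.

Lemma grad_snd_lipschitz_snd i u v v' :
  sq (gv i u v - gv i u v') <= L ^+ 2 * sq (v - v').
Proof.
have [_ _ _ h _] := f_smooth i; apply: sq_lipschitz (h u v v') _.
by rewrite L_def !le_max lexx !orbT.
Qed.

Lemma grad_snd_lipschitz_fst i u u' v :
  sq (gv i u v - gv i u' v) <= L ^+ 2 * sq (u - u').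
Proof.
have [_ _ _ _ h] := f_smooth i; apply: sq_lipschitz (h u u' v) _.
by rewrite L_def !le_max lexx !orbT.
Qed.

Lemma grad_fst_lipschitz i u u' v v' :
  sq (gu i u v - gu i u' v') <= 2 * L ^+ 2 * (sq (u - u') + sq (v - v')).
Proof.
rewrite -(subrKA (gu i u' v)); apply: le_trans (sqD_le _ _) _.
have := grad_fst_lipschitz_fst i u u' v.
by have := grad_fst_lipschitz_snd i u' v v'; lra.
Qed.

Lemma grad_snd_lipschitz i u u' v v' :
  sq (gv i u v - gv i u' v') <= 2 * L ^+ 2 * (sq (u - u') + sq (v - v')).
Proof.
rewrite -(subrKA (gv i u' v)); apply: le_trans (sqD_le _ _) _.
have := grad_snd_lipschitz_fst i u u' v.
by have := grad_snd_lipschitz_snd i u' v v'; lra.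
Qed.

(** Move [v] first with [u] fixed, then [u] at the new [v']. Replacing the gradient at (u, v') by
    the one at (u, v) costs a cross term, which Young's inequality with weight L splits into two
    halves; hence the coefficients L instead of L / 2. *)
Lemma local_loss_descent i u u' v v' :
  f i u' v' <= f i u v + dot (gu i u v) (u' - u) + dot (gv i u v) (v' - v)
    + L * sq (u' - u) + L * sq (v' - v).
Proof.
have [f_diff _ _ _ _] := f_smooth i.
have hu : f i u' v' <= f i u v' + dot (gu i u v') (u' - u) + L / 2 * sq (u' - u).
  apply: (descent_lemma (g := fun w => f i w v')) => //.
    by move=> w; have [] := f_diff w v'.
  by move=> w w'; exact: grad_fst_lipschitz_fst.
have hv : f i u v' <= f i u v + dot (gv i u v) (v' - v) + L / 2 * sq (v' - v).
  apply: descent_lemma => //.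
    by move=> w; have [] := f_diff u w.
  by move=> w w'; exact: grad_snd_lipschitz_snd.
have := dot_young (u' - u) (gu i u v' - gu i u v) L_gt0.
rewrite dotC dotDl dotNl => hx.
have : (2 * L)^-1 * sq (gu i u v' - gu i u v) <= L / 2 * sq (v' - v).
  apply: le_trans (ler_wpM2l _ (grad_fst_lipschitz_snd i u v' v)) _.
    by rewrite invr_ge0 mulr_ge0// ltW.
  by rewrite le_eqVlt; apply/orP; left; apply/eqP; field; rewrite gt_eqF.
by lra.
Qed.

Lemma loss_grad_uE u v : loss_grad_u F D u v = n%:R^-1 *: \sum_i gu i u (v i).
Proof.
apply/rowP => j; rewrite !mxE summxE.
have dg i : derivable (fun w => f i w (v i)) u (delta_mx 0 j).
  apply: diff_derivable; have [f_diff _ _ _ _] := f_smooth i.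
  by have [] := f_diff u (v i).
have -> : (fun u' => loss F D u' v) =
    n%:R^-1 \*: (\sum_i (fun w => f i w (v i))).
  by apply/funext => w; rewrite /loss /= fct_sumE.
rewrite deriveZ; last exact: derivable_sum.
by rewrite derive_sum//; congr (_ * _); apply: eq_bigr => i _; rewrite mxE.
Qed.

Lemma loss_descent u u' v v' :
  (0 < n)%N ->
  loss F D u' v' - loss F D u v <=
    dot (loss_grad_u F D u v) (u' - u)
    + n%:R^-1 * (\sum_i dot (gv i u (v i)) (v' i - v i))
    + L * sq (u' - u) + L * (n%:R^-1 * \sum_i sq (v' i - v i)).
Proof.
move=> n0; rewrite /loss -mulrBr -sumrB.
have n0R : 0 < n%:R :> R by rewrite ltr0n.
rewrite loss_grad_uE dotZl dot_suml.
rewrite (_ : L * sq (u' - u) = n%:R^-1 * \sum_(i < n) L * sq (u' - u)); last first.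
  rewrite sumr_const card_ord -[(L * _) *+ n]mulr_natl mulKf//.
  by rewrite gt_eqF.
rewrite [L * (_ * _)]mulrCA [L * \sum_(i < n) sq (v' i - v i)]mulr_sumr -!mulrDr -!big_split /=.
rewrite ler_pM2l ?invr_gt0//. apply: ler_sum => i _.
by have := local_loss_descent i u u' (v i) (v' i); lra.
Qed.

End Smoothness.

(** * Client drift and the averaged round *)

Section Client.
Context {R : realType}.

Lemma sq_sum_ord_le d (k : nat) (F : nat -> 'rV[R]_d) :
  sq (\sum_(j < k) F j) <= k%:R * \sum_(j < k) sq (F j).
Proof. by have := sq_sum_le xpredT (fun j : 'I_k => F j); rewrite card_ord. Qed.

(** [H] is the gradient along a local run, [N] its noise and [g0] the gradient at the start of the
    round. The noise is kept as one sum because its second moment grows like k, not k^2. *)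
Lemma displacementE d (k : nat) (c : R) (p H N : nat -> 'rV[R]_d) (g0 : 'rV[R]_d) :
  (forall j, p j.+1 = p j - c *: (H j + N j)) ->
  p k - p 0%N = - c *: (\sum_(j < k) N j
    + (k%:R *: g0 + \sum_(j < k) (H j - g0))).
Proof.
move=> pS.
have -> : k%:R *: g0 + \sum_(j < k) (H j - g0) = \sum_(j < k) H j.
  by rewrite sumrB sumr_const card_ord scaler_nat addrC subrK.
elim: k => [|k IH]; first by rewrite !big_ord0 subrr addr0 scaler0.
rewrite !big_ord_recr /= pS addrAC IH.
by apply/rowP => j; rewrite !mxE; ring.
Qed.

Let displacement_le d (k : nat) (c : R) (p H N : nat -> 'rV[R]_d) (g0 : 'rV[R]_d) :
  (forall j, p j.+1 = p j - c *: (H j + N j)) ->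
  sq (p k - p 0%N) <= c ^+ 2 * (2 * sq (\sum_(j < k) N j)
    + 4 * k%:R ^+ 2 * sq g0 + 4 * k%:R * \sum_(j < k) sq (H j - g0)).
Proof.
move=> pS; rewrite (displacementE k g0 pS).
rewrite sqZ sqrrN ler_wpM2l ?sqr_ge0//.
apply: le_trans (sqD_le _ _) _; rewrite -addrA lerD2l.
have h1 := sqD_le (k%:R *: g0) (\sum_(j < k) (H j - g0)).
have h2 := sq_sum_ord_le k (fun j => H j - g0).
rewrite sqZ in h1.
by lra.
Qed.

Context {du dv K : nat}.
Variables (L gamma gamma_u gamma_v : R).
Hypotheses (L_gt0 : 0 < L) (K_ge1 : (1 <= K)%N).
Hypotheses (gamma_u_ge0 : 0 <= gamma_u) (gamma_v_ge0 : 0 <= gamma_v).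
Hypotheses (gamma_u_le : gamma_u <= gamma) (gamma_v_le : gamma_v <= gamma).
Hypothesis gamma_le : gamma <= (32 * L * K%:R)^-1.
Variables (p H N : nat -> 'rV[R]_du) (q H' N' : nat -> 'rV[R]_dv).
Variables (g : 'rV[R]_du) (h : 'rV[R]_dv).
Hypothesis pS : forall k, p k.+1 = p k - gamma_u *: (H k + N k).
Hypothesis qS : forall k, q k.+1 = q k - gamma_v *: (H' k + N' k).

Let drift k := sq (p k - p 0%N) + sq (q k - q 0%N).

Hypothesis H_lip : forall k, sq (H k - g) <= 2 * L ^+ 2 * drift k.
Hypothesis H'_lip : forall k, sq (H' k - h) <= 2 * L ^+ 2 * drift k.

Let drift_ge0 k : 0 <= drift k.
Proof. by rewrite addr_ge0 ?sq_ge0. Qed.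

(** A self-bounding argument. Bounding each drift through the Lipschitz property brings back the
    total drift [S], with overall coefficient 1/64 because gamma L K <= 1/32. Absorbing S / 64 costs
    less than a factor 2, which turns the constants 2 and 4 of [drift_le] into 4 and 8. *)
Lemma client_drift_le :
  \sum_(k < K) drift k <=
    4 * \sum_(k < K) (gamma_u ^+ 2 * sq (\sum_(j < k) N j)
                      + gamma_v ^+ 2 * sq (\sum_(j < k) N' j))
    + 8 * K%:R ^+ 2 * (K%:R - 1) * (gamma_u ^+ 2 * sq g + gamma_v ^+ 2 * sq h).
Proof.
set kap : R := K%:R; set S := \sum_(k < K) drift k.
have kap1 : 1 <= kap by rewrite ler1n.
have S_ge0 : 0 <= S by apply: sumr_ge0 => k _; exact: drift_ge0.
set G := gamma_u ^+ 2 * sq g + gamma_v ^+ 2 * sq h.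
have G_ge0 : 0 <= G by rewrite addr_ge0// mulr_ge0 ?sqr_ge0 ?sq_ge0.
pose Q k := gamma_u ^+ 2 * sq (\sum_(j < k) N j)
             + gamma_v ^+ 2 * sq (\sum_(j < k) N' j).
have Q_ge0 k : 0 <= Q k by rewrite addr_ge0// mulr_ge0 ?sqr_ge0 ?sq_ge0.
have gamma_ge0 : 0 <= gamma by exact: le_trans gamma_u_le.
have gLk : gamma * (L * kap) <= 32^-1.
  have Lk0 : 0 < L * kap by rewrite mulr_gt0// (lt_le_trans ltr01).
  apply: le_trans (ler_wpM2r (ltW Lk0) gamma_le) _.
  rewrite le_eqVlt; apply/orP; left; apply/eqP.
  by rewrite -mulrA invfM -mulrA mulVf ?mulr1// gt_eqF.
have gLk2 : gamma ^+ 2 * (L * kap) ^+ 2 <= 1024^-1.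
  have gLk0 : 0 <= gamma * (L * kap).
    by rewrite !mulr_ge0// ?ltW// (le_trans ler01).
  have : (gamma * (L * kap)) ^+ 2 <= 32^-1 ^+ 2.
    by rewrite ler_pXn2r ?nnegrE ?invr_ge0.
  by rewrite exprMn; lra.
have gu2 : gamma_u ^+ 2 <= gamma ^+ 2 by rewrite ler_pXn2r ?nnegrE.
have gv2 : gamma_v ^+ 2 <= gamma ^+ 2 by rewrite ler_pXn2r ?nnegrE.
have drift_le (k : 'I_K) :
    drift k <= 2 * Q k + 4 * (kap * (kap - 1)) * G + 64^-1 / kap * S.
  (* Iterates counted in [S] have made at most K - 1 steps. This produces the factor K - 1 of the
     final bound, so that the drift disappears when K = 1. *)
  have k_le : k%:R <= kap - 1 :> R.
    by rewrite lerBrDr natr1 ler_nat.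
  have k0 : 0 <= k%:R :> R by [].
  have k2 : k%:R ^+ 2 <= kap * (kap - 1) :> R by rewrite expr2 ler_pM//; lra.
  have sumS : \sum_(j < k) drift j <= S.
    rewrite /S (big_ord_widen K (fun j => drift j) (ltnW (ltn_ord k))).
    rewrite [leRHS](bigID (fun j : 'I_K => (j < k)%N)) /= lerDl.
    by apply: sumr_ge0 => j _; exact: drift_ge0.
  have lipS d (F : nat -> 'rV[R]_d) :
      (forall j, sq (F j) <= 2 * L ^+ 2 * drift j) ->
      \sum_(j < k) sq (F j) <= 2 * L ^+ 2 * S.
    move=> hF; apply: le_trans (_ : 2 * L ^+ 2 * \sum_(j < k) drift j <= _).
      by rewrite mulr_sumr; apply: ler_sum => j _.
    by rewrite ler_wpM2l// mulr_ge0// sqr_ge0.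
  (* The constant is 8 / 1024: 4 from the displacement bound times 2 from the Lipschitz bound,
     against (gamma L K)^2 <= 1/1024. *)
  have lip_le d (c : R) (F : nat -> 'rV[R]_d) : c ^+ 2 <= gamma ^+ 2 ->
      (forall j, sq (F j) <= 2 * L ^+ 2 * drift j) ->
      c ^+ 2 * (4 * k%:R * \sum_(j < k) sq (F j)) <= 128^-1 / kap * S.
    move=> c2 hF.
    have h1 : 4 * k%:R * \sum_(j < k) sq (F j) <= 4 * kap * (2 * L ^+ 2 * S).
      apply: ler_pM; rewrite ?lipS// ?mulr_ge0//; last by lra.
      by apply: sumr_ge0 => j _; exact: sq_ge0.
    apply: le_trans (_ : gamma ^+ 2 * (4 * kap * (2 * L ^+ 2 * S)) <= _).
      apply: ler_pM => //; rewrite ?sqr_ge0 ?mulr_ge0//.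
      by apply: sumr_ge0 => j _; exact: sq_ge0.
    have -> : gamma ^+ 2 * (4 * kap * (2 * L ^+ 2 * S)) =
        8 * (gamma ^+ 2 * (L * kap) ^+ 2) * (S / kap).
      by field; rewrite gt_eqF// (lt_le_trans ltr01).
    have -> : 128^-1 / kap * S = 8 * 1024^-1 * (S / kap).
      by field; rewrite gt_eqF// (lt_le_trans ltr01).
    apply: ler_wpM2r; last exact: ler_wpM2l.
    by rewrite divr_ge0// (le_trans ler01).
  have hp := displacement_le k g pS.
  have hq := displacement_le k h qS.
  have h1 := lip_le _ gamma_u (fun j => H j - g) gu2 H_lip.
  have h2 := lip_le _ gamma_v (fun j => H' j - h) gv2 H'_lip.
  have G_le : 4 * k%:R ^+ 2 * G <= 4 * (kap * (kap - 1)) * G.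
    by rewrite ler_wpM2r// ler_wpM2l.
  apply: le_trans (lerD hp hq) _.
  have -> : gamma_u ^+ 2 * (2 * sq (\sum_(j < k) N j)
      + 4 * k%:R ^+ 2 * sq g + 4 * k%:R * \sum_(j < k) sq (H j - g))
    + gamma_v ^+ 2 * (2 * sq (\sum_(j < k) N' j)
      + 4 * k%:R ^+ 2 * sq h + 4 * k%:R * \sum_(j < k) sq (H' j - h)) =
    2 * Q k + 4 * k%:R ^+ 2 * G
    + gamma_u ^+ 2 * (4 * k%:R * \sum_(j < k) sq (H j - g))
    + gamma_v ^+ 2 * (4 * k%:R * \sum_(j < k) sq (H' j - h)).
    by rewrite /Q /G; ring.
  have -> : 64^-1 / kap * S = 128^-1 / kap * S + 128^-1 / kap * S.
    by field; rewrite gt_eqF// (lt_le_trans ltr01).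
  by lra.
have : S <= \sum_(k < K) (2 * Q k + 4 * (kap * (kap - 1)) * G + 64^-1 / kap * S).
  by apply: ler_sum => k _; exact: drift_le.
have sumc (c : R) : \sum_(k < K) c = kap * c.
  by rewrite sumr_const card_ord /kap mulr_natl.
rewrite !big_split /= -mulr_sumr !sumc.
set q1 := \sum_(k < K) Q k.
have q1_ge0 : 0 <= q1 by apply: sumr_ge0.
have G4 : 0 <= kap * (4 * (kap * (kap - 1)) * G).
  by rewrite !mulr_ge0//; lra.
have -> : kap * (64^-1 / kap * S) = 64^-1 * S.
  by field; rewrite gt_eqF// (lt_le_trans ltr01).
have -> : 8 * kap ^+ 2 * (kap - 1) * G = 2 * (kap * (4 * (kap * (kap - 1)) * G)).
  by ring.
move=> S_le; apply: (@le_trans _ _ (4 * q1 + 2 * (kap * (4 * (kap * (kap - 1)) * G)))).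
  by lra.
by rewrite /q1 big_split.
Qed.

Lemma client_error_le :
  sq (\sum_(k < K) (H k - g)) <= 2 * L ^+ 2 * K%:R * \sum_(k < K) drift k /\
  sq (\sum_(k < K) (H' k - h)) <= 2 * L ^+ 2 * K%:R * \sum_(k < K) drift k.
Proof.
have aux d (F : nat -> 'rV[R]_d) : (forall k, sq (F k) <= 2 * L ^+ 2 * drift k) ->
    sq (\sum_(k < K) F k) <= 2 * L ^+ 2 * K%:R * \sum_(k < K) drift k.
  move=> hF; apply: le_trans (sq_sum_ord_le _ _) _.
  rewrite -mulrA mulrCA ler_wpM2l// mulr_sumr.
  by apply: ler_sum => k _; exact: hF.
by split; [exact: (aux _ (fun k => H k - g))|exact: (aux _ (fun k => H' k - h))].
Qed.

End Client.

(** * Moments of a uniformly drawn subset *)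

Section SubsetMean.
Local Open Scope set_scope.
Context {R : realType} (n m : nat).
Hypotheses (m_ge1 : (1 <= m)%N) (m_le_n : (m <= n)%N).
Implicit Types (A : {set 'I_n}) (phi psi : {set 'I_n} -> R).

Definition subset_mean phi : R :=
  'C(n, m)%:R^-1 * \sum_(A : {set 'I_n} | #|A| == m) phi A.

Let bin_gt0R : 0 < 'C(n, m)%:R :> R.
Proof. by rewrite ltr0n bin_gt0. Qed.

Let n_gt0 : (0 < n)%N. Proof. exact: leq_trans m_le_n. Qed.
Let n_neq0 : n%:R != 0 :> R. Proof. by rewrite pnatr_eq0 -lt0n. Qed.
Let m_neq0 : m%:R != 0 :> R. Proof. by rewrite pnatr_eq0 -lt0n. Qed.

Lemma eq_subset_mean phi psi : (forall A, #|A| = m -> phi A = psi A) ->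
  subset_mean phi = subset_mean psi.
Proof. by move=> e; congr (_ * _); apply: eq_bigr => A /eqP /e. Qed.

Lemma le_subset_mean phi psi : (forall A, #|A| = m -> phi A <= psi A) ->
  subset_mean phi <= subset_mean psi.
Proof.
move=> h; rewrite ler_pM2l ?invr_gt0//.
by apply: ler_sum => A /eqP /h.
Qed.

Lemma subset_meanD phi psi :
  subset_mean (fun A => phi A + psi A) = subset_mean phi + subset_mean psi.
Proof. by rewrite /subset_mean big_split mulrDr. Qed.

Lemma subset_meanZ c phi :
  subset_mean (fun A => c * phi A) = c * subset_mean phi.
Proof. by rewrite /subset_mean -mulr_sumr mulrCA. Qed.

Lemma subset_mean_sum (I : finType) (phi : I -> {set 'I_n} -> R) :
  subset_mean (fun A => \sum_i phi i A) = \sum_i subset_mean (phi i).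
Proof. by rewrite /subset_mean exchange_big /= mulr_sumr. Qed.

Let count_subset (B : {set 'I_n}) :
  \sum_(A : {set 'I_n} | #|A| == m) (A \subset B)%:R = 'C(#|B|, m)%:R :> R.
Proof.
rewrite -cards_draws -sum1_card natr_sum big_mkcond [RHS]big_mkcond /=.
by apply: eq_bigr => A _; rewrite inE andbC; case: (_ == m); case: (_ \subset _).
Qed.

Lemma subset_mean_cst c : subset_mean (fun=> c) = c.
Proof.
rewrite /subset_mean (eq_bigr (fun A => c * (A \subset [set: 'I_n])%:R)).
  by rewrite -mulr_sumr count_subset cardsT card_ord mulrCA mulVf ?mulr1// gt_eqF.
by move=> A _; rewrite finset.subsetT mulr1.
Qed.

(** Non-membership is counted first, since the sets that miss given points are the subsets of a
    complement, which [count_subset] counts. Membership then follows by inclusion-exclusion. *)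
Let mean_notin i : subset_mean (fun A => (i \notin A)%:R) = (n%:R - m%:R) / n%:R.
Proof.
rewrite /subset_mean (eq_bigr (fun A => (A \subset [set~ i])%:R)); last first.
  by move=> A _; rewrite finset.subsetC finset.sub1set inE.
rewrite count_subset cardsC1 card_ord.
have := mul_bin_down n m => /(congr1 (fun k => k%:R : R)).
rewrite !natrM natrB// => e.
by apply: (mulfI n_neq0); rewrite mulrCA e; field; rewrite n_neq0 gt_eqF.
Qed.

Let mean_notin2 i j : i != j ->
  subset_mean (fun A => ((i \notin A) && (j \notin A))%:R) =
  (n%:R - m%:R) * (n%:R - m%:R - 1) / (n%:R * (n%:R - 1)).
Proof.
move=> ij; have n2 : (1 < n)%N.
  case: n i j ij => [|[|k]] // i j; first by case: i.
  by rewrite !ord1 eqxx.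
have n1 : n%:R - 1 != 0 :> R by rewrite subr_eq0 pnatr_eq1 gtn_eqF.
rewrite /subset_mean (eq_bigr (fun A => (A \subset ~: [set i; j])%:R)); last first.
  move=> A _; rewrite finset.subsetC finset.subUset !finset.sub1set.
  by rewrite !inE.
rewrite count_subset cardsCs finset.setCK cards2 ij card_ord.
have e1 : (n%:R : R) * 'C(n.-1, m)%:R = (n%:R - m%:R) * 'C(n, m)%:R.
  by rewrite -natrM mul_bin_down natrM natrB.
have e2 : (n%:R - 1 : R) * 'C(n - 2, m)%:R = (n%:R - m%:R - 1) * 'C(n.-1, m)%:R.
  have -> : (n - 2 = n.-1.-1)%N by rewrite subn2.
  have -> : n%:R - 1 = n.-1%:R :> R by rewrite -subn1 natrB.
  rewrite -natrM mul_bin_down natrM.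
  (* If m = n, the truncated difference n.-1 - m is not the real number n - m - 1, but the binomial
     coefficient that multiplies it is zero. *)
  move: m_le_n; rewrite leq_eqVlt => /predU1P[->|mn].
    by rewrite bin_small ?mulr0// prednK.
  rewrite natrB; last by rewrite -ltnS prednK.
  by rewrite -subn1 natrB//; ring.
have e3 : (n%:R * (n%:R - 1) : R) * 'C(n - 2, m)%:R =
    (n%:R - m%:R) * (n%:R - m%:R - 1) * 'C(n, m)%:R.
  by rewrite -(mulrA n%:R) e2 mulrCA e1; ring.
apply: (mulfI (mulf_neq0 n_neq0 n1)); rewrite mulrCA e3.
by field; rewrite n_neq0 n1 gt_eqF.
Qed.

Let mean_in i : subset_mean (fun A => (i \in A)%:R) = m%:R / n%:R.
Proof.
rewrite (eq_subset_mean (psi := fun A => 1 + -1 * (i \notin A)%:R)).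
  by rewrite subset_meanD subset_meanZ subset_mean_cst mean_notin; field.
by move=> A _; case: (i \in A) => /=; ring.
Qed.

Let mean_in2 i j : i != j -> subset_mean (fun A => ((i \in A) && (j \in A))%:R) =
  m%:R * (m%:R - 1) / (n%:R * (n%:R - 1)).
Proof.
move=> ij; have n2 : (1 < n)%N.
  case: n i j ij => [|[|k]] // i j; first by case: i.
  by rewrite !ord1 eqxx.
have n1 : n%:R - 1 != 0 :> R by rewrite subr_eq0 pnatr_eq1 gtn_eqF.
rewrite (eq_subset_mean (psi := fun A => 1 + (-1 * (i \notin A)%:R
  + (-1 * (j \notin A)%:R + ((i \notin A) && (j \notin A))%:R)))).
  rewrite !subset_meanD !subset_meanZ subset_mean_cst !mean_notin mean_notin2//.
  by field; rewrite n_neq0 n1.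
by move=> A _; case: (i \in A); case: (j \in A) => /=; ring.
Qed.

Lemma subset_mean_sum_in (x : 'I_n -> R) :
  subset_mean (fun A => \sum_(i in A) x i) = m%:R / n%:R * \sum_i x i.
Proof.
rewrite (eq_subset_mean (psi := fun A => \sum_i x i * (i \in A)%:R)).
  rewrite subset_mean_sum mulr_sumr; apply: eq_bigr => i _.
  by rewrite subset_meanZ mean_in mulrC.
move=> A _; rewrite big_mkcond; apply: eq_bigr => i _.
by case: (i \in A); rewrite ?mulr1 ?mulr0.
Qed.

Lemma subset_mean_sq_sum_le d (x : 'I_n -> 'rV[R]_d) :
  subset_mean (fun A => sq (m%:R^-1 *: \sum_(i in A) x i)) <=
  n%:R^-1 * \sum_i sq (x i).
Proof.
have -> : n%:R^-1 * \sum_i sq (x i) =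
    subset_mean (fun A => m%:R^-1 * \sum_(i in A) sq (x i)).
  by rewrite subset_meanZ subset_mean_sum_in mulrA [m%:R / _]mulrC mulrCA mulVf ?mulr1// mulrC.
apply: le_subset_mean => A Am; rewrite sqZ expr2 -mulrA ler_wpM2l ?invr_ge0//.
rewrite -[leRHS](mulKf m_neq0) ler_wpM2l ?invr_ge0// -Am.
exact: sq_sum_le.
Qed.

(** Sampling without replacement. The second moment is computed exactly from the probabilities [p1]
    and [p2] that one, respectively two distinct, indices are drawn; convexity alone would lose the
    factor n - m, which vanishes under full participation. *)
Lemma subset_mean_sq_sum_bias d (x : 'I_n -> 'rV[R]_d) (b2 : R) :
  0 <= b2 ->
  let xbar := n%:R^-1 *: \sum_i x i in
  n%:R^-1 * \sum_i sq (x i) <= b2 + sq xbar ->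
  subset_mean (fun A => sq (m%:R^-1 *: \sum_(i in A) x i)) <=
  sq xbar + 2 * (n%:R - m%:R) / (m%:R * n%:R) * b2.
Proof.
move=> b2_ge0 xbar hb.
have mR : 1 <= m%:R :> R by rewrite ler1n.
have mnR : m%:R <= n%:R :> R by rewrite ler_nat.
(* n - 1 is a denominator below. For n = 1 one has m = n, and the drawn set is everything. *)
have [n1|n2] := leqP n 1.
  have nm : n = m by apply/eqP; rewrite eqn_leq m_le_n (leq_trans n1).
  rewrite (eq_subset_mean (psi := fun=> sq xbar)).
    by rewrite subset_mean_cst lerDl mulr_ge0// divr_ge0 ?mulr_ge0//; lra.
  move=> A Am; have -> : A = [set: 'I_n].
    by apply/eqP; rewrite eqEcard finset.subsetT cardsT card_ord Am nm leqnn.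
  have -> : m%:R = n%:R :> R by rewrite [in RHS]nm.
  by congr (sq (_ *: _)); apply: eq_bigl => i; rewrite inE.
have nR : 2 <= n%:R :> R by rewrite (ler_nat _ 2).
pose p1 : R := m%:R / n%:R; pose p2 : R := m%:R * (m%:R - 1) / (n%:R * (n%:R - 1)).
set s1 := \sum_i sq (x i) in hb *; set s2 := sq (\sum_i x i).
have sE : subset_mean (fun A => sq (\sum_(i in A) x i)) = (p1 - p2) * s1 + p2 * s2.
  rewrite (eq_subset_mean (psi := fun A => \sum_i \sum_j
      dot (x i) (x j) * ((i \in A) && (j \in A))%:R)); last first.
    move=> A _; rewrite /sq dot_suml big_mkcond; apply: eq_bigr => i _.
    case: (i \in A) => /=; last by rewrite big1// => j _; rewrite mulr0.
    rewrite dot_sumr big_mkcond; apply: eq_bigr => j _.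
    by case: (j \in A); rewrite ?mulr1 ?mulr0.
  rewrite subset_mean_sum.
  under eq_bigr do rewrite subset_mean_sum.
  rewrite /s1 /s2 {2}/sq dot_suml [(p1 - p2) * _]mulr_sumr [p2 * _]mulr_sumr
    -big_split; apply: eq_bigr => i _.
  rewrite dot_sumr /= (bigD1 i)//= [in RHS](bigD1 i)//= mulrDr addrA.
  congr (_ + _).
    rewrite subset_meanZ (eq_subset_mean (psi := fun A => (i \in A)%:R)).
      by rewrite mean_in -/p1 /sq; ring.
    by move=> A _; rewrite andbb.
  rewrite mulr_sumr; apply: eq_bigr => j ji; rewrite subset_meanZ mean_in2 1?eq_sym//.
  by rewrite /p2; ring.
rewrite (eq_subset_mean (psi := fun A => m%:R^-1 ^+ 2 * sq (\sum_(i in A) x i))).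
  rewrite subset_meanZ sE.
  have s2E : s2 = n%:R ^+ 2 * sq xbar.
    by rewrite /xbar sqZ mulrA -exprMn divff// expr1n mul1r.
  have s1E : s1 = n%:R * (n%:R^-1 * s1) by rewrite mulrA divff// mul1r.
  rewrite s2E s1E; move: hb; set t := n%:R^-1 * s1 => hb.
  have n10 : n%:R - 1 != 0 :> R by rewrite gt_eqF//; lra.
  have p12 : p1 - p2 = m%:R * (n%:R - m%:R) / (n%:R * (n%:R - 1)).
    by rewrite /p1 /p2; field; rewrite n10 n_neq0.
  have p12_ge0 : 0 <= p1 - p2.
    by rewrite p12 divr_ge0 ?mulr_ge0//; lra.
  apply: (@le_trans _ _ (m%:R^-1 ^+ 2 * ((p1 - p2) * (n%:R * (b2 + sq xbar))
    + p2 * (n%:R ^+ 2 * sq xbar)))).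
    by rewrite ler_wpM2l ?sqr_ge0// lerD2r ler_wpM2l// ler_wpM2l.
  (* After the dissimilarity bound is inserted, the two contributions to [sq xbar] add up to
     coefficient exactly 1. *)
  have -> : m%:R^-1 ^+ 2 * ((p1 - p2) * (n%:R * (b2 + sq xbar))
      + p2 * (n%:R ^+ 2 * sq xbar)) =
      sq xbar + (n%:R - m%:R) / (m%:R * (n%:R - 1)) * b2.
    by rewrite p12 /p2; field; rewrite n10 n_neq0 m_neq0.
  (* The factor 2 of the statement comes from n - 1 >= n / 2, valid for n >= 2. *)
  rewrite lerD2l ler_wpM2r//.
  have -> : (n%:R - m%:R) / (m%:R * (n%:R - 1)) =
    (n%:R - m%:R) / m%:R * (n%:R - 1)^-1 :> R by field; rewrite n10 m_neq0.
  have -> : 2 * (n%:R - m%:R) / (m%:R * n%:R) =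
    (n%:R - m%:R) / m%:R * (n%:R / 2)^-1 :> R by field; rewrite n_neq0 m_neq0.
  rewrite ler_wpM2l ?divr_ge0//; first lra.
  by rewrite lef_pV2 ?posrE; lra.
by move=> A _; rewrite sqZ.
Qed.

End SubsetMean.

(** * Pathwise bound for a round averaged over the selected set *)

Section RoundBound.
Context {R : realType} {n m du dv : nat}.
Hypotheses (m_ge1 : (1 <= m)%N) (m_le_n : (m <= n)%N).
Variables (L gamma gamma_u gamma_v kap b : R).
Hypotheses (L_gt0 : 0 < L) (kap_ge1 : 1 <= kap) (gamma_gt0 : 0 < gamma).
Hypothesis gamma_le : gamma * (L * kap) <= 32^-1.
Hypothesis gamma_u2 : gamma_u ^+ 2 <= gamma ^+ 2.
Hypothesis gamma_v2 : gamma_v ^+ 2 <= gamma ^+ 2 * (m%:R / n%:R).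
Variables (g S E : 'I_n -> 'rV[R]_du) (h S' E' : 'I_n -> 'rV[R]_dv).
Variables (Q drift : 'I_n -> R).

Let gbar := n%:R^-1 *: \sum_i g i.

Hypothesis dissim : n%:R^-1 * \sum_i sq (g i) <= b ^+ 2 + sq gbar.
Hypothesis E_le : forall i, sq (E i) <= 2 * L ^+ 2 * kap * drift i.
Hypothesis E'_le : forall i, sq (E' i) <= 2 * L ^+ 2 * kap * drift i.
Hypothesis drift_ge0 : forall i, 0 <= drift i.
Hypothesis drift_le : forall i, drift i <= 4 * Q i
  + 8 * kap ^+ 2 * (kap - 1)
    * (gamma_u ^+ 2 * sq (g i) + gamma_v ^+ 2 * sq (h i)).

(** The total stochastic gradient used by client [i] in one round: noise, initial gradient and drift
    error. [dU A] and [dV A] are the updates when [A] is the selected set. *)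
Let step i := S i + (kap *: g i + E i).
Let step' i := S' i + (kap *: h i + E' i).
Let dU (A : {set 'I_n}) := - (gamma / m%:R) *: \sum_(i in A) step i.
Let dV (A : {set 'I_n}) i := if i \in A then - gamma *: step' i else 0.

Let n_gt0 : 0 < n%:R :> R.
Proof. by rewrite ltr0n (leq_trans m_ge1). Qed.
Let m_gt0 : 0 < m%:R :> R.
Proof. by rewrite ltr0n. Qed.
Let kap_gt0 : 0 < kap. Proof. exact: lt_le_trans ltr01 kap_ge1. Qed.

Let Lg_ge0 : 0 <= L * gamma ^+ 2.
Proof. by rewrite mulr_ge0 ?sqr_ge0// ltW. Qed.

(** One factor 1 / n comes from the loss, and m / n is the probability that a given client is
    selected. *)
Let H := m%:R / n%:R ^+ 2 * \sum_i sq (h i).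
Let dbar := n%:R^-1 * \sum_i drift i.

(** Young's inequality with weight kap: the drift error gives back half of the decrease kap |x|^2,
    and the factor kap in the bound on [e] cancels. *)
Let dot_error_le d (x e : 'rV[R]_d) i :
  sq e <= 2 * L ^+ 2 * kap * drift i ->
  - dot x e <= kap / 2 * sq x + L ^+ 2 * drift i.
Proof.
move=> he; have := dot_young (- x) e kap_gt0; rewrite dotNl sqN => hy.
apply: le_trans hy _; rewrite lerD2l.
apply: le_trans (ler_wpM2l _ he) _; first by rewrite invr_ge0 mulr_ge0// ltW.
by rewrite le_eqVlt; apply/orP; left; apply/eqP; field; rewrite gt_eqF.
Qed.

Let linear_fst : subset_mean m (fun A => dot gbar (dU A)) <=
  gamma * (- dot gbar (n%:R^-1 *: \sum_i S i) - kap / 2 * sq gbar + L ^+ 2 * dbar).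
Proof.
rewrite (eq_subset_mean (psi := fun A => - (gamma / m%:R) *
    \sum_(i in A) dot gbar (step i))); last first.
  by move=> A _; rewrite dotZr dot_sumr.
rewrite subset_meanZ subset_mean_sum_in//.
have -> : - (gamma / m%:R) * (m%:R / n%:R * \sum_i dot gbar (step i)) =
    gamma * (n%:R^-1 * \sum_i - dot gbar (step i)).
  by rewrite sumrN; field; rewrite !gt_eqF.
rewrite ler_pM2l//.
have -> : dot gbar (n%:R^-1 *: \sum_i S i) = n%:R^-1 * \sum_i dot gbar (S i).
  by rewrite dotZr dot_sumr.
have gE : sq gbar = n%:R^-1 * \sum_i dot gbar (g i).
  by rewrite {1}/sq {2}/gbar dotZr dot_sumr.
have sumE : n%:R^-1 * \sum_i - dot gbar (step i) =
    - (n%:R^-1 * \sum_i dot gbar (S i)) - kap * sq gbar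
    + n%:R^-1 * \sum_i - dot gbar (E i).
  rewrite gE (eq_bigr (fun i => - dot gbar (S i)
    + (- (kap * dot gbar (g i)) + - dot gbar (E i)))).
    by rewrite big_split /= big_split /= !sumrN -mulr_sumr; ring.
  by move=> i _; rewrite /step !dotDr dotZr !opprD.
have errE : n%:R^-1 * \sum_i - dot gbar (E i) <= kap / 2 * sq gbar + L ^+ 2 * dbar.
  have -> : kap / 2 * sq gbar + L ^+ 2 * dbar =
      n%:R^-1 * \sum_i (kap / 2 * sq gbar + L ^+ 2 * drift i).
    rewrite big_split /= mulrDr sumr_const card_ord -[(kap / 2 * _) *+ n]mulr_natl.
    by rewrite mulKf ?gt_eqF// -mulr_sumr /dbar mulrCA.
  rewrite ler_pM2l ?invr_gt0//; apply: ler_sum => i _.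
  exact: dot_error_le.
by rewrite sumE; lra.
Qed.

Let linear_snd : subset_mean m (fun A => n%:R^-1 * \sum_i dot (h i) (dV A i)) <=
  gamma * (- (m%:R / n%:R ^+ 2 * \sum_i dot (h i) (S' i)) - kap / 2 * H
           + L ^+ 2 * dbar).
Proof.
rewrite (eq_subset_mean (psi := fun A => gamma / n%:R *
    \sum_(i in A) - dot (h i) (step' i))); last first.
  move=> A _; rewrite [RHS]mulrAC mulrC; congr (_ / _).
  rewrite mulr_sumr [RHS]big_mkcond; apply: eq_bigr => i _.
  by rewrite /dV; case: (i \in A); rewrite ?dot0r// dotZr mulNr mulrN.
rewrite subset_meanZ subset_mean_sum_in//.
have -> : gamma / n%:R * (m%:R / n%:R * \sum_i - dot (h i) (step' i)) =
    gamma * (m%:R / n%:R ^+ 2 * \sum_i - dot (h i) (step' i)).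
  by field; rewrite !gt_eqF.
rewrite ler_pM2l//.
apply: (@le_trans _ _ (m%:R / n%:R ^+ 2 *
    \sum_i (- dot (h i) (S' i) - kap / 2 * sq (h i) + L ^+ 2 * drift i))).
  rewrite ler_wpM2l ?divr_ge0 ?sqr_ge0//; apply: ler_sum => i _.
  have := dot_error_le (h i) (E'_le i).
  by rewrite /step' !dotDr dotZr -/(sq _); lra.
rewrite big_split /= big_split /= !sumrN -!mulr_sumr.
have dbar_ge0 : 0 <= dbar by rewrite mulr_ge0 ?invr_ge0 ?sumr_ge0.
(* Only the drift gives up its factor m / n; the gradient and noise terms keep it. *)
have mn : m%:R / n%:R ^+ 2 * (L ^+ 2 * \sum_i drift i) =
    m%:R / n%:R * (L ^+ 2 * dbar) by rewrite /dbar; field; rewrite gt_eqF.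
have mn1 : m%:R / n%:R * (L ^+ 2 * dbar) <= L ^+ 2 * dbar.
  apply: ler_piMl; first by rewrite mulr_ge0 ?sqr_ge0.
  by rewrite ler_pdivrMr// mul1r ler_nat.
rewrite !mulrDr mn mulrN /H; lra.
Qed.

(** The noise is split off first, so it keeps the constant 2, and the other two parts get 4 each.
    The exact sampling moment is used for the initial gradients, where dissimilarity is known; for
    the drift errors convexity is enough. *)
Let quadratic_fst : subset_mean m (fun A => L * sq (dU A)) <=
  L * gamma ^+ 2 * (2 * subset_mean m (fun A => sq (m%:R^-1 *: \sum_(i in A) S i))
  + 4 * kap ^+ 2 * (sq gbar + 2 * (n%:R - m%:R) / (m%:R * n%:R) * b ^+ 2)
  + 8 * L ^+ 2 * kap * dbar).
Proof.
pose avg (x : 'I_n -> 'rV[R]_du) (A : {set 'I_n}) := m%:R^-1 *: \sum_(i in A) x i.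
have stepE A : avg step A = avg S A + (kap *: avg g A + avg E A).
  by rewrite /avg !big_split /= -scaler_sumr !scalerDr [_ *: (_ *: _)]scalerA
    mulrC -scalerA.
apply: (@le_trans _ _ (subset_mean m (fun A => L * gamma ^+ 2 *
   (2 * sq (avg S A) + (4 * kap ^+ 2 * sq (avg g A) + 4 * sq (avg E A)))))).
  apply: le_subset_mean => // A _.
  have -> : dU A = - gamma *: avg step A by rewrite /dU scalerA mulNr.
  rewrite sqZ sqrrN mulrA ler_wpM2l ?Lg_ge0//.
  rewrite stepE; apply: le_trans (sqD_le _ _) _; rewrite lerD2l.
  by have := sqD_le (kap *: avg g A) (avg E A); rewrite sqZ; lra.
rewrite subset_meanZ !subset_meanD !subset_meanZ.
rewrite ler_wpM2l ?Lg_ge0// -addrA lerD2l.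
apply: lerD.
  apply: ler_wpM2l; first by rewrite mulr_ge0 ?sqr_ge0.
  exact: (subset_mean_sq_sum_bias m_ge1 m_le_n (sqr_ge0 b) dissim).
have -> : 8 * L ^+ 2 * kap * dbar = 4 * (n%:R^-1 * \sum_i 2 * L ^+ 2 * kap * drift i).
  by rewrite /dbar -mulr_sumr; ring.
rewrite ler_wpM2l//; apply: le_trans (subset_mean_sq_sum_le _ _ _) _ => //.
by rewrite ler_pM2l ?invr_gt0//; apply: ler_sum => i _.
Qed.

Let quadratic_snd :
  subset_mean m (fun A => L * (n%:R^-1 * \sum_i sq (dV A i))) <=
  L * gamma ^+ 2 * (2 * (m%:R / n%:R ^+ 2 * \sum_i sq (S' i)) + 4 * kap ^+ 2 * H
  + 8 * L ^+ 2 * kap * dbar).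
Proof.
rewrite (eq_subset_mean (psi := fun A => L * gamma ^+ 2 * n%:R^-1 *
    \sum_(i in A) sq (step' i))); last first.
  move=> A _; have -> : \sum_i sq (dV A i) = gamma ^+ 2 * \sum_(i in A) sq (step' i).
    rewrite mulr_sumr [RHS]big_mkcond; apply: eq_bigr => i _.
    by rewrite /dV; case: (i \in A); rewrite ?sq0// sqZ sqrrN.
  by ring.
rewrite subset_meanZ subset_mean_sum_in//.
have -> : L * gamma ^+ 2 / n%:R * (m%:R / n%:R * \sum_i sq (step' i)) =
    L * gamma ^+ 2 * (m%:R / n%:R ^+ 2 * \sum_i sq (step' i)).
  by field; rewrite !gt_eqF.
rewrite ler_wpM2l ?Lg_ge0//.
apply: (@le_trans _ _ (m%:R / n%:R ^+ 2 * \sum_i (2 * sq (S' i)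
    + 4 * kap ^+ 2 * sq (h i) + 8 * L ^+ 2 * kap * drift i))).
  rewrite ler_wpM2l ?divr_ge0 ?sqr_ge0//; apply: ler_sum => i _.
  apply: le_trans (sqD_le _ _) _.
  have := sqD_le (kap *: h i) (E' i); rewrite sqZ => h1.
  by have := E'_le i; lra.
rewrite big_split /= big_split /= -!mulr_sumr.
have dbar_ge0 : 0 <= dbar by rewrite mulr_ge0 ?invr_ge0 ?sumr_ge0.
set X := 8 * L ^+ 2 * kap.
have X0 : 0 <= X by rewrite !mulr_ge0 ?sqr_ge0// ltW.
have mn : m%:R / n%:R ^+ 2 * (X * \sum_i drift i) =
    m%:R / n%:R * (X * dbar) by rewrite /dbar; field; rewrite gt_eqF.
have mn1 : m%:R / n%:R * (X * dbar) <= X * dbar.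
  apply: ler_piMl; first by rewrite mulr_ge0.
  by rewrite ler_pdivrMr// mul1r ler_nat.
by rewrite !mulrDr mn /H; lra.
Qed.

(** The linear parts contribute 1 + 1 and the quadratic parts at most 1/4 + 1/4 to the coefficient
    of gamma L^2 [dbar]. The drift bound multiplied by 5/2 gives the constants 10 and 20. For the
    gradient norms, 1/2 - 1/8 - 20/1024 is at least 1/4. *)
Lemma subset_mean_round_le :
  subset_mean m (fun A => dot gbar (dU A) + n%:R^-1 * (\sum_i dot (h i) (dV A i))
    + L * sq (dU A) + L * (n%:R^-1 * \sum_i sq (dV A i))) <=
  - gamma * dot gbar (n%:R^-1 *: \sum_i S i)
  - gamma * (m%:R / n%:R ^+ 2 * \sum_i dot (h i) (S' i))
  + 2 * L * gamma ^+ 2 * subset_mean m (fun A => sq (m%:R^-1 *: \sum_(i in A) S i))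
  + 2 * L * gamma ^+ 2 * (m%:R / n%:R ^+ 2 * \sum_i sq (S' i))
  + 10 * gamma * L ^+ 2 * (n%:R^-1 * \sum_i Q i)
  - gamma * kap / 4 * (sq gbar + m%:R / n%:R ^+ 2 * \sum_i sq (h i))
  + (8 * L * gamma ^+ 2 * kap ^+ 2 * (n%:R - m%:R) / (m%:R * n%:R) * b ^+ 2
     + 20 * gamma * L ^+ 2 * kap ^+ 2 * (kap - 1) * gamma_u ^+ 2 * b ^+ 2).
Proof.
rewrite !subset_meanD.
have h1 := linear_fst; have h2 := linear_snd.
have h3 := quadratic_fst; have h4 := quadratic_snd.
rewrite -/H.
set M := subset_mean m (fun A => sq (m%:R^-1 *: \sum_(i in A) S i)) in h3 *.
set W := m%:R / n%:R ^+ 2 * \sum_i sq (S' i) in h4 *.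
set qbar := n%:R^-1 * \sum_i Q i.
have dbar_ge0 : 0 <= dbar by rewrite mulr_ge0 ?invr_ge0 ?sumr_ge0.
have H_ge0 : 0 <= H.
  rewrite mulr_ge0 ?divr_ge0 ?sqr_ge0//.
  by apply: sumr_ge0 => i _; exact: sq_ge0.
pose x := gamma * (L * kap).
have x_ge0 : 0 <= x by rewrite !mulr_ge0// ltW.
have k1 : 0 <= kap - 1 by rewrite subr_ge0.
have dbar_le : dbar <= 4 * qbar + 8 * kap ^+ 2 * (kap - 1) *
    (gamma_u ^+ 2 * (b ^+ 2 + sq gbar) + gamma ^+ 2 * H).
  have c_ge0 : 0 <= 8 * kap ^+ 2 * (kap - 1).
    by rewrite !mulr_ge0 ?(ltW kap_gt0).
  apply: (@le_trans _ _ (4 * qbar + 8 * kap ^+ 2 * (kap - 1) *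
      (gamma_u ^+ 2 * (n%:R^-1 * \sum_i sq (g i))
       + gamma_v ^+ 2 * (n%:R^-1 * \sum_i sq (h i))))).
    apply: (@le_trans _ _ (n%:R^-1 * \sum_i (4 * Q i + 8 * kap ^+ 2 * (kap - 1)
        * (gamma_u ^+ 2 * sq (g i) + gamma_v ^+ 2 * sq (h i))))).
      by rewrite ler_pM2l ?invr_gt0//; apply: ler_sum => i _; exact: drift_le.
    rewrite big_split /= -!mulr_sumr big_split /= -!mulr_sumr.
    by rewrite le_eqVlt; apply/orP; left; apply/eqP; rewrite /qbar; ring.
  rewrite lerD2l ler_wpM2l//; apply: lerD; first by rewrite ler_wpM2l ?sqr_ge0.
  (* The bound on [gamma_v] supplies the factor m / n that turns the plain average of the [sq (h i)]
     into [H]. *)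
  have -> : gamma ^+ 2 * H = gamma ^+ 2 * (m%:R / n%:R) *
      (n%:R^-1 * \sum_i sq (h i)) by rewrite /H; field; rewrite gt_eqF.
  rewrite ler_wpM2r// mulr_ge0 ?invr_ge0//.
  by apply: sumr_ge0 => i _; exact: sq_ge0.
have x2 : x ^+ 2 <= 1024^-1.
  by have : x ^+ 2 <= 32^-1 ^+ 2; [rewrite ler_pXn2r ?nnegrE ?invr_ge0|lra].
have gkp (y : R) : 0 <= y -> 0 <= gamma * kap * y.
  by move=> y0; rewrite !mulr_ge0// ltW.
have a1 (y : R) : 0 <= y -> L * gamma ^+ 2 * (4 * kap ^+ 2 * y) <= 8^-1 * (gamma * kap * y).
  move=> y0; have -> : L * gamma ^+ 2 * (4 * kap ^+ 2 * y) = 4 * x * (gamma * kap * y).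
    by rewrite /x; ring.
  by apply: ler_wpM2r; [exact: gkp|move: gamma_le; rewrite -/x; lra].
have a2 : L * gamma ^+ 2 * (8 * L ^+ 2 * kap * dbar) <= 4^-1 * (gamma * L ^+ 2 * dbar).
  have -> : L * gamma ^+ 2 * (8 * L ^+ 2 * kap * dbar) = 8 * x * (gamma * L ^+ 2 * dbar).
    by rewrite /x; ring.
  apply: ler_wpM2r; last by move: gamma_le; rewrite -/x; lra.
  by do ![done|exact: ltW|apply: mulr_ge0].
have a3 : gamma * L ^+ 2 * dbar <= gamma * L ^+ 2 * (4 * qbar + 8 * kap ^+ 2 * (kap - 1) *
    (gamma_u ^+ 2 * (b ^+ 2 + sq gbar) + gamma ^+ 2 * H)).
  by apply: ler_wpM2l dbar_le; do ![done|exact: ltW|apply: mulr_ge0].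
have a4 (c y : R) : c <= gamma ^+ 2 -> 0 <= y ->
    20 * gamma * L ^+ 2 * kap ^+ 2 * (kap - 1) * c * y <= 20 * 1024^-1 * (gamma * kap * y).
  move=> cg y0.
  apply: (@le_trans _ _ (20 * gamma * L ^+ 2 * kap ^+ 2 * kap * gamma ^+ 2 * y)).
    rewrite ler_wpM2r//.
    apply: (@le_trans _ _ (20 * gamma * L ^+ 2 * kap ^+ 2 * (kap - 1) * gamma ^+ 2)).
      by apply: ler_wpM2l cg; do ![done|exact: ltW|apply: mulr_ge0].
    rewrite ler_wpM2r ?sqr_ge0//; apply: ler_wpM2l; last by lra.
    by do ![done|exact: ltW|apply: mulr_ge0].
  have -> : 20 * gamma * L ^+ 2 * kap ^+ 2 * kap * gamma ^+ 2 * y =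
      20 * x ^+ 2 * (gamma * kap * y) by rewrite /x; ring.
  by rewrite ler_wpM2r ?gkp// ler_wpM2l.
have b1 := a1 _ (sq_ge0 gbar); have b2 := a1 _ H_ge0.
have b3 := a4 _ _ gamma_u2 (sq_ge0 gbar); have b4 := a4 _ _ (lexx _) H_ge0.
have gH := gkp _ H_ge0; have gG := gkp _ (sq_ge0 gbar).
move: h1 h2 h3 h4 a2 a3 b1 b2 b3 b4 gH gG.
set D1 := dot gbar _; set D2 := _ * \sum_i dot (h i) (S' i).
set l1 := subset_mean m _; set l2 := subset_mean m _.
set l3 := subset_mean m _; set l4 := subset_mean m _.
move=> h1 h2 h3 h4 a2 a3 b1 b2 b3 b4 gH gG.
apply: le_trans (lerD (lerD (lerD h1 h2) h3) h4) _.
by lra.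
Qed.

End RoundBound.

(** * Square integrable random vectors and gradient noise *)

Section CoordMeasurable.
Context {R : realType} {dT : measure_display} {T : measurableType dT} {d : nat}.
Implicit Types U V : T -> 'rV[R]_d.

Lemma coord_measurable_cst (u : 'rV[R]_d) : coord_measurable (fun _ : T => u).
Proof. by move=> j; exact: measurable_cst. Qed.

Lemma coord_measurableD U V : coord_measurable U -> coord_measurable V ->
  coord_measurable (fun t => U t + V t).
Proof.
by move=> mU mV j; under eq_fun do rewrite mxE; exact: measurable_funD.
Qed.

Lemma coord_measurableZ a U : coord_measurable U ->
  coord_measurable (fun t => a *: U t).
Proof.
move=> mU j; under eq_fun do rewrite mxE.
by apply: measurable_funM => //; exact: measurable_cst.
Qed.

Lemma measurable_dot U V : coord_measurable U -> coord_measurable V ->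
  measurable_fun setT (fun t => dot (U t) (V t)).
Proof.
move=> mU mV; apply: measurable_sum => j.
exact: measurable_funM.
Qed.

Lemma coord_measurable_if (f : T -> bool) U V : measurable_fun setT f ->
  coord_measurable U -> coord_measurable V ->
  coord_measurable (fun t => if f t then U t else V t).
Proof.
move=> mf mU mV j.
rewrite (_ : (fun t => _) = (fun t => if f t then U t 0 j else V t 0 j)).
  exact: measurable_fun_ifT.
by apply/funext => t; case: (f t).
Qed.

End CoordMeasurable.

Lemma measurable_fun_g_sigma {d d'} {T : measurableType d}
    {S : measurableType d'} (C C' : set (set T)) (f : T -> S) :
  <<s C >> `<=` <<s C' >> ->
  measurable_fun (setT : set (g_sigma_algebraType C)) (f : g_sigma_algebraType C -> S) ->
  measurable_fun (setT : set (g_sigma_algebraType C')) (f : g_sigma_algebraType C' -> S).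
Proof. by move=> CC' mf mT B mB; apply: CC'; exact: mf. Qed.

Lemma measurable_fun_of_g_sigma {d d'} {T : measurableType d}
    {S : measurableType d'} (C : set (set T)) (f : T -> S) :
  C `<=` measurable ->
  measurable_fun (setT : set (g_sigma_algebraType C)) (f : g_sigma_algebraType C -> S) ->
  measurable_fun setT f.
Proof.
move=> Cm mf _ B mB; apply: (smallest_sub (@sigma_algebra_measurable _ T) Cm).
exact: mf.
Qed.

Section SquareIntegrable.
Context {R : realType} {dO : measure_display} {Omega : measurableType dO}.
Variable P : probability Omega R.

Definition integ (f : Omega -> R) := P.-integrable setT (EFin \o f).

Lemma integ_cst c : integ (fun=> c).
Proof. exact: finite_measure_integrable_cst. Qed.

Lemma Rintegral_prob_cst (c : R) : \int[P]_w c = c.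
Proof.
rewrite Rintegral_cst// [X in c * fine X](_ : _ = 1%E) ?mulr1//.
exact: probability_setT.
Qed.

Lemma integD f g : integ f -> integ g -> integ (fun w => f w + g w).
Proof. by move=> fi gi; have := integrableD measurableT fi gi. Qed.

Lemma integB f g : integ f -> integ g -> integ (fun w => f w - g w).
Proof. by move=> fi gi; have := integrableB measurableT fi gi. Qed.

Lemma integZ c f : integ f -> integ (fun w => c * f w).
Proof. by move=> fi; have := integrableZl measurableT c fi. Qed.

Lemma integ_sum (I : Type) (r : seq I) (Q : pred I) (F : I -> Omega -> R) :
  (forall i, Q i -> integ (F i)) -> integ (fun w => \sum_(i <- r | Q i) F i w).
Proof.
move=> h; have := integrable_sum measurableT r h.
by apply: eq_integrable => // w _; rewrite /= sumEFin.
Qed.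

Lemma le_integ (f g : Omega -> R) : measurable_fun setT f -> (forall w, `|f w| <= g w) ->
  integ g -> integ f.
Proof.
move=> mf fg; apply: le_integrable => //; first exact/measurable_EFinP.
move=> w _ /=; rewrite lee_fin; apply: le_trans (fg w) _; exact: ler_norm.
Qed.

Lemma Rintegral_sum (I : Type) (r : seq I) (Q : pred I) (F : I -> Omega -> R) :
  (forall i, Q i -> integ (F i)) ->
  \int[P]_w (\sum_(i <- r | Q i) F i w) = \sum_(i <- r | Q i) \int[P]_w F i w.
Proof.
move=> h; elim: r => [|i r IH].
  by under eq_Rintegral do rewrite big_nil; rewrite big_nil /Rintegral integral0.
rewrite big_cons -IH; case: ifPn => Qi.
  rewrite -RintegralD//; [|exact: h|exact: integ_sum].
  by apply: eq_Rintegral => w _; rewrite big_cons Qi.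
by apply: eq_Rintegral => w _; rewrite big_cons (negbTE Qi).
Qed.

Lemma Rintegral_le_cst (f : Omega -> R) (c : R) : measurable_fun setT f ->
  (forall w, 0 <= f w) -> (\int[P]_w (f w)%:E <= c%:E)%E ->
  integ f /\ \int[P]_w f w <= c.
Proof.
move=> mf f0 fc; have fi : integ f.
  apply/integrableP; split; first exact/measurable_EFinP.
  apply: le_lt_trans (ltry c); apply: le_trans fc.
  rewrite le_eqVlt; apply/orP; left; apply/eqP; apply: eq_integral => w _ /=.
  by rewrite ger0_norm.
split => //; rewrite -lee_fin /Rintegral fineK//.
exact: integrable_fin_num.
Qed.

Lemma integ_coord d (U : Omega -> 'rV[R]_d) j : coord_measurable U ->
  integ (fun w => sq (U w)) -> integ (fun w => U w 0 j).
Proof.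
move=> mU iU; apply: (@le_integ _ (fun w => 1 + sq (U w))) => //.
  move=> w; have := coord_sqr_le (U w) j.
  have := sqr_ge0 (U w 0 j - 1); have := sqr_ge0 (U w 0 j + 1).
  by rewrite ler_norml !expr2; nra.
by apply: integD => //; exact: integ_cst.
Qed.

(** Square integrable vectors adapted to the history [C]: measurability refers to the sigma-algebra
    generated by [C], integrability to [P] on [Omega]. *)
Definition sqv (C : set (set Omega)) d (U : Omega -> 'rV[R]_d) : Prop :=
  coord_measurable (U : g_sigma_algebraType C -> 'rV[R]_d) /\
  integ (fun w => sq (U w)).

Section ClosureProperties.
Variable C : set (set Omega).
Hypothesis Cm : C `<=` measurable.
Variable d : nat.
Implicit Types U V : Omega -> 'rV[R]_d.

Lemma sqv_measurable U : sqv C U -> coord_measurable U.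
Proof. by move=> [mU _] j; exact: (measurable_fun_of_g_sigma Cm (mU j)). Qed.

Lemma sqv_integ U : sqv C U -> integ (fun w => sq (U w)).
Proof. by case. Qed.

Lemma sqv_cst (u : 'rV[R]_d) : sqv C (fun=> u).
Proof. by split; [exact: coord_measurable_cst|exact: integ_cst]. Qed.

Lemma sqv_dom U (f : Omega -> R) : coord_measurable (U : g_sigma_algebraType C -> 'rV[R]_d) ->
  (forall w, sq (U w) <= f w) -> integ f -> sqv C U.
Proof.
move=> mU Uf fi; split=> //; apply: le_integ fi.
  by apply: measurable_dot => j; exact: (measurable_fun_of_g_sigma Cm (mU j)).
by move=> w; rewrite ger0_norm ?sq_ge0.
Qed.

Lemma sqvD U V : sqv C U -> sqv C V -> sqv C (fun w => U w + V w).
Proof.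
move=> [mU iU] [mV iV].
apply: (@sqv_dom _ (fun w => 2 * sq (U w) + 2 * sq (V w))).
- exact: (coord_measurableD mU mV).
- by move=> w; exact: sqD_le.
- by apply: integD; exact: integZ.
Qed.

Lemma sqvZ a U : sqv C U -> sqv C (fun w => a *: U w).
Proof.
move=> [mU iU]; apply: (@sqv_dom _ (fun w => a ^+ 2 * sq (U w))).
- exact: (coord_measurableZ _ mU).
- by move=> w; rewrite sqZ.
- exact: integZ.
Qed.

Lemma sqvB U V : sqv C U -> sqv C V -> sqv C (fun w => U w - V w).
Proof.
move=> hU hV; have := sqvD hU (sqvZ (-1) hV).
by under eq_fun do rewrite scaleN1r.
Qed.

Lemma sqv_sum (I : Type) (r : seq I) (Q : pred I) (F : I -> Omega -> 'rV[R]_d) :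
  (forall i, Q i -> sqv C (F i)) -> sqv C (fun w => \sum_(i <- r | Q i) F i w).
Proof.
move=> h; elim: r => [|i r IH].
  by under eq_fun do rewrite big_nil; exact: sqv_cst.
under eq_fun do rewrite big_cons; case: (boolP (Q i)) => // Qi.
by apply: sqvD; [exact: h|exact: IH].
Qed.

Lemma sqv_if (f : Omega -> bool) U V :
  measurable_fun (setT : set (g_sigma_algebraType C)) (f : g_sigma_algebraType C -> bool) ->
  sqv C U -> sqv C V -> sqv C (fun w => if f w then U w else V w).
Proof.
move=> mf [mU iU] [mV iV].
apply: (@sqv_dom _ (fun w => sq (U w) + sq (V w))).
- exact: (coord_measurable_if (T := g_sigma_algebraType C)).
- by move=> w; case: ifP => _; rewrite ?lerDl ?lerDr sq_ge0.
- exact: integD.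
Qed.

End ClosureProperties.

Lemma sqv_dot (C C' : set (set Omega)) d (U V : Omega -> 'rV[R]_d) :
  C `<=` measurable -> C' `<=` measurable ->
  sqv C U -> sqv C' V -> integ (fun w => dot (U w) (V w)).
Proof.
move=> Cm C'm hU hV; apply: (@le_integ _ (fun w => sq (U w) + sq (V w))).
- by apply: measurable_dot; [exact: sqv_measurable hU|exact: sqv_measurable hV].
- move=> w; rewrite ler_norml.
  have := sqD_le (U w) (V w); have := sq_ge0 (U w + V w).
  have := sq_ge0 (U w - V w); rewrite sqB sqD.
  by have := sq_ge0 (U w); have := sq_ge0 (V w); lra.
- by apply: integD; [exact: sqv_integ hU|exact: sqv_integ hV].
Qed.

Lemma sqv_sub (C C' : set (set Omega)) d (U : Omega -> 'rV[R]_d) :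
  <<s C >> `<=` <<s C' >> -> sqv C U -> sqv C' U.
Proof.
by move=> CC' [mU iU]; split=> // j; exact: measurable_fun_g_sigma (mU j).
Qed.

(** A Lipschitz map grows at most linearly from its value at (0, 0), hence preserves square
    integrability. *)
Lemma sqv_lipschitz (C : set (set Omega)) d d' d'' (L : R)
    (g : 'rV[R]_d -> 'rV[R]_d' -> 'rV[R]_d'') U V :
  C `<=` measurable ->
  (forall u u' v, sq (g u v - g u' v) <= L ^+ 2 * sq (u - u')) ->
  (forall u v v', sq (g u v - g u v') <= L ^+ 2 * sq (v - v')) ->
  sqv C U -> sqv C V -> sqv C (fun w => g (U w) (V w)).
Proof.
move=> Cm gu gv [mU iU] [mV iV].
apply: (@sqv_dom _ Cm _ _ (fun w => 2 * (L ^+ 2 * sq (U w))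
    + 2 * (2 * (L ^+ 2 * sq (V w)) + 2 * sq (g 0 0)))).
- exact: (coord_measurable_lipschitz gu gv mU mV).
- move=> w; rewrite -(subrK (g 0 (V w)) (g _ _)).
  apply: le_trans (sqD_le _ _) _; apply: lerD.
    by have := gu (U w) 0 (V w); rewrite subr0; lra.
  rewrite ler_wpM2l// -(subrK (g 0 0) (g 0 (V w))).
  apply: le_trans (sqD_le _ _) _; rewrite lerD2r.
  by have := gv 0 (V w) 0; rewrite subr0; lra.
- by do ![exact: integ_cst | apply: integZ | apply: integD | done].
Qed.

End SquareIntegrable.

Section Noise.
Context {R : realType} {dO dX : measure_display}.
Context {Omega : measurableType dO} {Xi : measurableType dX}.
Variables (P : probability Omega R) (C : set (set Omega)).
Hypothesis Cm : C `<=` measurable.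
Variables (X : {mfun Omega >-> Xi}) (mu : probability Xi R).
Hypothesis X_indep : forall A B, <<s C >> A -> measurable B ->
  P (A `&` X @^-1` B) = (P A * mu B)%E.
Context {du dv d : nat}.
Variables (noise : 'rV[R]_du -> 'rV[R]_dv -> Xi -> 'rV[R]_d) (s : R).
(** Quantified over the source space because it is used on [Omega], on [Omega] with a coarser
    sigma-algebra, on the product with the sample space, and on the sample space itself. *)
Hypothesis noise_measurable : forall dT (T : measurableType dT)
  (U : T -> 'rV[R]_du) (V : T -> 'rV[R]_dv) (Y : T -> Xi),
  coord_measurable U -> coord_measurable V -> measurable_fun setT Y ->
  coord_measurable (fun t => noise (U t) (V t) (Y t)).
Hypothesis noise_mean : forall u v j, (\int[mu]_x (noise u v x 0 j)%:E = 0)%E.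
Hypothesis noise_var : forall u v, (\int[mu]_x (sq (noise u v x))%:E <= s%:E)%E.
Variables (U : Omega -> 'rV[R]_du) (V : Omega -> 'rV[R]_dv).
Hypotheses (hU : sqv P C U) (hV : sqv P C V).

Let noiseX w := noise (U w) (V w) (X w).

Let coord_measurable_fst e (W : Omega -> 'rV[R]_e) : sqv P C W ->
  coord_measurable (fun z : (g_sigma_algebraType C * Xi)%type => W z.1).
Proof.
by move=> [mW _] j; exact: (measurableT_comp (mW j) measurable_fst).
Qed.

Let noise_joint : coord_measurable
  (fun z : (g_sigma_algebraType C * Xi)%type => noise (U z.1) (V z.1) z.2).
Proof.
by apply: noise_measurable; [exact: coord_measurable_fst..|exact: measurable_snd].
Qed.

Lemma noise_sq : integ P (fun w => sq (noiseX w)) /\ \int[P]_w sq (noiseX w) <= s.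
Proof.
apply: Rintegral_le_cst => //.
- apply: measurable_dot; apply: noise_measurable => //;
    by [exact: sqv_measurable hU|exact: sqv_measurable hV].
- by move=> w; exact: sq_ge0.
- apply: (indep_ge0_integral_le Cm X_indep
    (h := fun z => (sq (noise (U z.1) (V z.1) z.2))%:E)).
  + by apply/measurable_EFinP; exact: measurable_dot.
  + by move=> z; rewrite lee_fin sq_ge0.
  + by move=> w; exact (noise_var (U w) (V w)).
Qed.

Lemma sqv_noise (C' : set (set Omega)) : C' `<=` measurable ->
  <<s C >> `<=` <<s C' >> ->
  measurable_fun (setT : set (g_sigma_algebraType C'))
    (X : g_sigma_algebraType C' -> Xi) ->
  sqv P C' noiseX.
Proof.
move=> C'm CC' mX; split; last by have [] := noise_sq.
apply: (@noise_measurable _ (g_sigma_algebraType C')) => //.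
  by have [] := sqv_sub CC' hU.
by have [] := sqv_sub CC' hV.
Qed.

Let noise_integrable u v j : mu.-integrable setT (fun x => (noise u v x 0 j)%:E).
Proof.
have mN : coord_measurable (noise u v).
  by apply: (@noise_measurable _ _ (fun=> u) (fun=> v) id) => //;
    exact: coord_measurable_cst.
have [iN _] : integ mu (fun x => sq (noise u v x)) /\ \int[mu]_x sq (noise u v x) <= s.
  apply: Rintegral_le_cst => //; first exact: measurable_dot.
  by move=> x; exact: sq_ge0.
exact: integ_coord.
Qed.

(** Once the history is frozen, [phi], [U] and [V] are constants, and the inner integral is a linear
    combination of the vanishing means of the noise coordinates. *)
Lemma noise_orthogonal (phi : Omega -> 'rV[R]_d) : sqv P C phi ->
  integ P (fun w => dot (phi w) (noiseX w)) ->
  \int[P]_w dot (phi w) (noiseX w) = 0.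
Proof.
move=> hphi iphi; rewrite /Rintegral.
rewrite (indep_integral_eq0 Cm X_indep
  (h := fun z => (dot (phi z.1) (noise (U z.1) (V z.1) z.2))%:E)) //.
- apply/measurable_EFinP; apply: measurable_dot => //.
  exact: coord_measurable_fst.
- move=> w /=; under eq_integral do rewrite /dot -sumEFin.
  rewrite integral_sum//; last first.
    by move=> j; under eq_fun do rewrite EFinM; exact: integrableZl.
  rewrite big1// => j _; under eq_integral do rewrite EFinM.
  by rewrite integralZl// noise_mean mule0.
Qed.

End Noise.

(** * The draws and iterates of FedAvg-P *)

Section Draws.
Context {R : realType} {d dXi : measure_display}.
Context {Omega : measurableType d} {Xi : measurableType dXi} {n : nat}.
Variables (P : probability Omega R) (D : 'I_n -> probability Xi R).
Variables (T K m : nat).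
Variables (Sel : nat -> Omega -> {set 'I_n}).
Variables (xi : nat -> 'I_n -> nat -> {RV P >-> Xi}).
Hypothesis draws : fedavgp_draws D T K m Sel xi.

Local Notation index := ('I_T + 'I_T * 'I_n * 'I_K)%type.

Definition history (J : {set index}) : set (set Omega) :=
  joint_system (draw_sigma Sel xi) J.

Lemma draw_sigma_measurable (j : index) : draw_sigma Sel xi j `<=` measurable.
Proof.
have [hS _ _] := draws; case: j => [t|[[t i] k]] E /= [B mB <-]; rewrite setTI.
  rewrite (_ : Sel t @^-1` B = \bigcup_(A in B) (Sel t @^-1` [set A])).
    apply: fin_bigcup_measurable; first exact: finite_finset.
    by move=> A _; have [] := hS t (ltn_ord t) A.
  rewrite eqEsubset; split=> w /=; first by move=> Bw; exists (Sel t w).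
  by move=> [A BA /= ->].
by rewrite -[X in measurable X]setTI; exact: measurable_funP.
Qed.

Lemma history_measurable (J : {set index}) : history J `<=` measurable.
Proof. by apply: joint_system_measurable; exact: draw_sigma_measurable. Qed.

Lemma history_sub (J J' : {set index}) : J \subset J' ->
  <<s history J >> `<=` <<s history J' >>.
Proof.
move=> /fintype.subsetP JJ'; apply: sub_smallest2r => // A [j Jj GA].
by exists j => //; exact: JJ'.
Qed.

Lemma history_indep (J : {set index}) (j : index) : j \notin J ->
  indep_systems P <<s history J >> (draw_sigma Sel xi j).
Proof.
have [_ _ hI] := draws => jJ.
apply: (mutually_independent_joint_system draw_sigma_measurable) => // {jJ}{j}.
  by case=> [t|[[t i] k]]; exists setT => //; rewrite setTI preimage_setT.
case=> [t|[[t i] k]] _ _ [A mA <-] [B mB <-]; exists (A `&` B);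
  by [|exact: measurableI|rewrite !setTI].
Qed.

Lemma measurable_history_Sel dS (S : measurableType dS) (J : {set index})
    (t : 'I_T) (f : {set 'I_n} -> S) : inl t \in J ->
  measurable_fun (setT : set (g_sigma_algebraType (history J)))
    (fun w : g_sigma_algebraType (history J) => f (Sel t w)).
Proof.
move=> tJ _ B mB; rewrite setTI; apply: sub_sigma_algebra.
by exists (inl t) => //; exists (f @^-1` B) => //; rewrite setTI.
Qed.

Lemma measurable_history_xi (J : {set index}) (t : 'I_T) i (k : 'I_K) :
  inr (t, i, k) \in J ->
  measurable_fun (setT : set (g_sigma_algebraType (history J)))
    (xi t i k : g_sigma_algebraType (history J) -> Xi).
Proof.
move=> tJ _ B mB; rewrite setTI; apply: sub_sigma_algebra.
by exists (inr (t, i, k)) => //; exists B => //; rewrite setTI.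
Qed.

Lemma history_indep_xi (J : {set index}) (t : 'I_T) i (k : 'I_K) A B :
  inr (t, i, k) \notin J -> <<s history J >> A -> measurable B ->
  P (A `&` xi t i k @^-1` B) = (P A * D i B)%E.
Proof.
move=> tJ hA mB; have [_ hL _] := draws.
rewrite (history_indep tJ)//; last by exists B => //; rewrite setTI.
by rewrite -(hL t i k).
Qed.

(** The freezing argument is applied to the centred indicator of the selection times [Y]. *)
Lemma history_indep_Sel (J : {set index}) (t : 'I_T) (A : {set 'I_n})
    (Y : Omega -> R) : inl t \notin J ->
  measurable_fun (setT : set (g_sigma_algebraType (history J)))
    (Y : g_sigma_algebraType (history J) -> R) ->
  integ P Y ->
  integ P (fun w => (Sel t w == A)%:R * Y w) /\
  \int[P]_w ((Sel t w == A)%:R * Y w) =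
    (if #|A| == m then 'C(n, m)%:R^-1 else 0) * \int[P]_w Y w.
Proof.
move=> tJ mY iY; have [hS _ _] := draws.
have [mA PA] := hS t (ltn_ord t) A.
set p := (if _ then _ else _) in PA *.
have mf : measurable_fun setT (fun w => Sel t w == A).
  apply: (measurable_fun_bool true); rewrite setTI.
  rewrite (_ : _ @^-1` _ = Sel t @^-1` [set A])//.
  by rewrite eqEsubset; split=> w /= => [/eqP|->]; rewrite ?eqxx.
(* The selection is seen only through this boolean, a random element of a measurable type, as the
   Fubini lemma requires. *)
pose f : {mfun Omega >-> bool} := HB.pack (fun w => Sel t w == A)
  (isMeasurableFun.Build _ _ _ _ _ mf).
pose mu := distribution P f.
have f_indep B B' : <<s history J >> B -> measurable B' ->
    P (B `&` f @^-1` B') = (P B * mu B')%E.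
  move=> hB mB'; rewrite (history_indep tJ)//.
  by exists [set A' | B' (A' == A)] => //; rewrite setTI.
have mbool : measurable_fun setT (fun b : bool => b%:R : R) by move=> _ B mB.
have mfR : measurable_fun setT (fun w => (Sel t w == A)%:R : R).
  exact: (measurableT_comp mbool mf).
have ifR : integ P (fun w => (Sel t w == A)%:R).
  apply: (@le_integ _ _ _ _ _ (fun=> 1)) => //; last exact: integ_cst.
  by move=> w; case: (_ == _); rewrite ?normr1 ?normr0.
have EfR : \int[P]_w ((Sel t w == A)%:R - p) = 0.
  rewrite RintegralB//; last exact: integ_cst.
  have -> : (fun w => (Sel t w == A)%:R) = \1_(Sel t @^-1` [set A]) :> (Omega -> R).
    apply/funext => w; rewrite indicE; congr (nat_of_bool _)%:R.
    by apply/eqP/idP => [SA|]; rewrite inE.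
  rewrite Rintegral_prob_cst.
  rewrite /Rintegral integral_indic// setIT; apply/eqP; rewrite subr_eq0.
  exact/eqP/(congr1 fine PA).
have mYO : measurable_fun setT Y.
  exact: (measurable_fun_of_g_sigma (@history_measurable J) mY).
have iAY : integ P (fun w => (Sel t w == A)%:R * Y w).
  apply: (@le_integ _ _ _ _ _ (fun w => `|Y w|)).
  - exact: measurable_funM.
  - by move=> w; case: (_ == _); rewrite ?mul1r// mul0r normr0.
  - exact: integrable_norm.
split=> //.
suff : \int[P]_w (((f w)%:R - p) * Y w) = 0.
  under eq_Rintegral do rewrite mulrBl.
  rewrite RintegralB//; last exact: integZ.
  by rewrite RintegralZl//; move=> /eqP; rewrite subr_eq0 => /eqP.
rewrite /Rintegral (indep_integral_eq0 (@history_measurable J) f_indep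
  (h := fun z => ((z.2%:R - p) * Y z.1)%:E))//.
- apply/measurable_EFinP; apply: measurable_funM.
    apply: measurable_funB => //.
    exact: (measurableT_comp mbool measurable_snd).
  exact: (measurableT_comp mY measurable_fst).
- have := integB iAY (integZ p iY).
  by apply: eq_integrable => // w _; rewrite /= mulrBl.
- move=> w; under eq_integral do rewrite /= EFinM.
  have iB : mu.-integrable setT (fun b : bool => (b%:R - p)%:E).
    apply: integrable_pushforward => //.
    by have := integB ifR (integ_cst P p).
  rewrite integralZr// integral_distribution//.
  - rewrite [X in (X * _)%E](_ : _ = 0%E) ?mul0e//.
    rewrite -[0%E]/(0%:E) -EfR /Rintegral fineK//.
    by apply: integrable_fin_num => //; have := integB ifR (integ_cst P p).
  by have := integB ifR (integ_cst P p).
Qed.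

End Draws.

(** * Orthogonality of noise increments over steps and clients *)

Section NoiseSums.
Context {R : realType} {dO : measure_display} {Omega : measurableType dO}.
Variables (P : probability Omega R) (n m K d : nat).
(** [C0] is the past of the round, [Cstep i k] what client [i] has used before its step [k], and
    [Cother i k] a history that also contains the runs of the other clients and for which the
    increment [N i k] is still centred. *)
Variables (C0 : set (set Omega)) (Cstep Cother : 'I_n -> nat -> set (set Omega)).
Hypotheses (C0_m : C0 `<=` measurable).
Hypothesis Cstep_m : forall i k, Cstep i k `<=` measurable.
Hypothesis C0_step : forall i, <<s C0 >> `<=` <<s Cstep i 0%N >>.
Hypothesis Cstep_mono : forall i k k', (k <= k')%N ->
  <<s Cstep i k >> `<=` <<s Cstep i k' >>.
Hypothesis Cstep_other : forall i k, <<s Cstep i k >> `<=` <<s Cother i k >>.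
Hypothesis Cstep_other_client : forall i i' k k', i' != i ->
  <<s Cstep i' k' >> `<=` <<s Cother i k >>.
Variables (N : 'I_n -> nat -> Omega -> 'rV[R]_d) (s : R).
Hypothesis N_sqv : forall i k, (k < K)%N -> sqv P (Cstep i k.+1) (N i k).
Hypothesis N_sq : forall i k, (k < K)%N -> \int[P]_w sq (N i k w) <= s.
Hypothesis N_orthogonal : forall i k (phi : Omega -> 'rV[R]_d), (k < K)%N ->
  sqv P (Cother i k) phi -> \int[P]_w dot (phi w) (N i k w) = 0.

Definition noise_sum i k w : 'rV[R]_d := \sum_(j < k) N i j w.

Lemma noise_sum_sqv i k : (k <= K)%N -> sqv P (Cstep i k) (noise_sum i k).
Proof.
move=> kK; apply: sqv_sum => // j _.
apply: sqv_sub (N_sqv i _); first exact: Cstep_mono.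
exact: leq_trans kK.
Qed.

Lemma noise_sum_orthogonal i k (phi : Omega -> 'rV[R]_d) C : (k <= K)%N ->
  C `<=` measurable -> (forall j, (j < k)%N -> <<s C >> `<=` <<s Cother i j >>) ->
  sqv P C phi -> \int[P]_w dot (phi w) (noise_sum i k w) = 0.
Proof.
move=> kK Cm CC hphi; under eq_Rintegral do rewrite /noise_sum dot_sumr.
rewrite Rintegral_sum; last first.
  move=> j _; apply: (sqv_dot Cm _ hphi (N_sqv i _)) => //.
  exact: leq_trans kK.
rewrite big1// => j _; apply: N_orthogonal; first exact: leq_trans kK.
by apply: sqv_sub hphi; exact: CC.
Qed.

Lemma noise_sum_past i k (phi : Omega -> 'rV[R]_d) : (k <= K)%N ->
  sqv P C0 phi -> \int[P]_w dot (phi w) (noise_sum i k w) = 0.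
Proof.
move=> kK; apply: noise_sum_orthogonal => // j _ A /C0_step hA.
by apply: Cstep_other; exact: (@Cstep_mono i 0%N j (leq0n j)).
Qed.

(** The martingale computation: the cross term with the next increment vanishes, so variances add
    up. *)
Lemma noise_sum_sq_le i k : (k <= K)%N ->
  \int[P]_w sq (noise_sum i k w) <= k%:R * s.
Proof.
elim: k => [_|k IH kK].
  under eq_Rintegral do rewrite /noise_sum big_ord0 sq0.
  by rewrite Rintegral_prob_cst mul0r.
have hS := noise_sum_sqv i (ltnW kK); have hN := N_sqv i kK.
have iSN : integ P (fun w => dot (noise_sum i k w) (N i k w)).
  exact: sqv_dot hS hN.
have iS := sqv_integ hS; have iN := sqv_integ hN.
have -> : \int[P]_w sq (noise_sum i k.+1 w) =
    \int[P]_w (sq (noise_sum i k w) + 2 * dot (noise_sum i k w) (N i k w)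
               + sq (N i k w)).
  by apply: eq_Rintegral => w _; rewrite -sqD /noise_sum big_ord_recr.
rewrite RintegralD//; last by apply: integD => //; exact: integZ.
rewrite RintegralD//; last exact: integZ.
rewrite RintegralZl// N_orthogonal//; last by apply: sqv_sub hS; exact: Cstep_other.
rewrite mulr0 addr0 -natr1 mulrDl mul1r.
by apply: lerD; [exact/IH/ltnW|exact: N_sq].
Qed.

(** The full noise sum of one client is measurable for a history given which every increment of the
    other is centred, even though the two runs are simultaneous. *)
Lemma noise_sum_cross i i' : i' != i ->
  \int[P]_w dot (noise_sum i' K w) (noise_sum i K w) = 0.
Proof.
move=> ii'; apply: (noise_sum_orthogonal (C := Cstep i' K)) => //.
  by move=> j _; exact: Cstep_other_client.
exact: noise_sum_sqv.
Qed.

(** Only the m diagonal terms survive, which yields the gain 1 / m over a single client. *)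
Lemma noise_sum_mean_sq_le (A : {set 'I_n}) : (0 < m)%N -> #|A| = m ->
  \int[P]_w sq (m%:R^-1 *: \sum_(i in A) noise_sum i K w) <= K%:R * s / m%:R.
Proof.
move=> m0 Am; have hS i := noise_sum_sqv i (leqnn K).
have iSS i i' : integ P (fun w => dot (noise_sum i K w) (noise_sum i' K w)).
  exact: sqv_dot (hS i) (hS i').
have -> : \int[P]_w sq (m%:R^-1 *: \sum_(i in A) noise_sum i K w) =
    \int[P]_w (m%:R^-1 ^+ 2 * \sum_(i in A) \sum_(i' in A)
      dot (noise_sum i K w) (noise_sum i' K w)).
  apply: eq_Rintegral => w _; rewrite sqZ /sq dot_suml; congr (_ * _).
  by apply: eq_bigr => i _; rewrite dot_sumr.
have iSA i : integ P (fun w => \sum_(i' in A) dot (noise_sum i K w) (noise_sum i' K w)).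
  exact: integ_sum.
rewrite RintegralZl//; last exact: integ_sum.
rewrite Rintegral_sum//.
apply: (@le_trans _ _ (m%:R^-1 ^+ 2 * \sum_(i in A) K%:R * s)).
  rewrite ler_wpM2l ?sqr_ge0//; apply: ler_sum => i iA.
  rewrite Rintegral_sum// (bigD1 i)//= big1 ?addr0; first exact: noise_sum_sq_le.
  by move=> i' /andP[_ i'i]; apply: noise_sum_cross; rewrite eq_sym.
rewrite sumr_const Am -[(K%:R * s) *+ m]mulr_natl.
rewrite le_eqVlt; apply/orP; left; apply/eqP; field.
by rewrite pnatr_eq0 -lt0n.
Qed.

End NoiseSums.

(** * Gradient noise along the run *)

Section GradientNoise.
Context {R : realType} {dXi : measure_display} {Xi : measurableType dXi}.
Context {n du dv : nat}.
Variables (D : 'I_n -> probability Xi R).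
Variables (F : 'rV[R]_du -> 'rV[R]_dv -> Xi -> R).
Variables (Lu Luv Lv Lvu L sigma_u sigma_v : R).
Hypothesis F_diff : forall x, partially_differentiable (fun u v => F u v x).
Hypothesis F_int : forall i u v, (D i).-integrable setT (EFin \o F u v).
Hypothesis f_smooth : smoothness F D Lu Luv Lv Lvu.
Hypothesis L_def : L = Num.max (Num.max Lu Lv) (Num.max Luv Lvu).
Hypothesis L_gt0 : 0 < L.
Hypothesis F_unbiased : unbiased_gradients F D.
Hypothesis F_variance : bounded_variance F D sigma_u sigma_v.

Local Notation f := (local_loss F D).

Definition noise_u i u v x := stoch_grad_u F u v x - grad_fst (f i) u v.
Definition noise_v i u v x := stoch_grad_v F u v x - grad_snd (f i) u v.

Let F_meas (i : 'I_n) u v : measurable_fun setT (F u v).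
Proof. by apply/measurable_EFinP; exact: (measurable_int (D i)). Qed.

Lemma noise_u_measurable i dT (T : measurableType dT)
    (U : T -> 'rV[R]_du) (V : T -> 'rV[R]_dv) (Y : T -> Xi) :
  coord_measurable U -> coord_measurable V -> measurable_fun setT Y ->
  coord_measurable (fun t => noise_u i (U t) (V t) (Y t)).
Proof.
move=> mU mV mY.
have h1 := coord_measurable_stoch_grad_u F_diff (F_meas i) mU mV mY.
have h2 := coord_measurable_lipschitz (grad_fst_lipschitz_fst f_smooth L_def L_gt0 i)
  (grad_fst_lipschitz_snd f_smooth L_def L_gt0 i) mU mV.
have := coord_measurableD h1 (coord_measurableZ (-1) h2).
by under eq_fun do rewrite scaleN1r.
Qed.

Lemma noise_v_measurable i dT (T : measurableType dT)
    (U : T -> 'rV[R]_du) (V : T -> 'rV[R]_dv) (Y : T -> Xi) :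
  coord_measurable U -> coord_measurable V -> measurable_fun setT Y ->
  coord_measurable (fun t => noise_v i (U t) (V t) (Y t)).
Proof.
move=> mU mV mY.
have h1 := coord_measurable_stoch_grad_v F_diff (F_meas i) mU mV mY.
have h2 := coord_measurable_lipschitz (grad_snd_lipschitz_fst f_smooth L_def L_gt0 i)
  (grad_snd_lipschitz_snd f_smooth L_def L_gt0 i) mU mV.
have := coord_measurableD h1 (coord_measurableZ (-1) h2).
by under eq_fun do rewrite scaleN1r.
Qed.

Lemma noise_u_var i u v :
  (\int[D i]_x (sq (noise_u i u v x))%:E <= (sigma_u ^+ 2)%:E)%E.
Proof.
have [h _] := F_variance i u v; move: h; rewrite unlock.
by under eq_integral do rewrite enorm_sqr.
Qed.

Lemma noise_v_var i u v :
  (\int[D i]_x (sq (noise_v i u v x))%:E <= (sigma_v ^+ 2)%:E)%E.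
Proof.
have [_ h] := F_variance i u v; move: h; rewrite unlock.
by under eq_integral do rewrite enorm_sqr.
Qed.

(** Splitting the integral of G - c requires [G] to be integrable. This is drawn from the variance
    bound, [G] being a coordinate of a square integrable vector plus a constant. *)
Let centered_mean (i : 'I_n) d (N : Xi -> 'rV[R]_d) (j : 'I_d) (G : Xi -> R) (c s : R) :
  coord_measurable N -> (\int[D i]_x (sq (N x))%:E <= s%:E)%E ->
  (forall x, N x 0 j = G x - c) -> (\int[D i]_x (G x)%:E = c%:E)%E ->
  (\int[D i]_x (N x 0 j)%:E = 0)%E.
Proof.
move=> mN Ns NG Gc.
have [iN _] : integ (D i) (fun x => sq (N x)) /\ \int[D i]_x sq (N x) <= s.
  apply: Rintegral_le_cst => //; first exact: measurable_dot.
  by move=> x; exact: sq_ge0.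
have iNj : integ (D i) (fun x => N x 0 j) by exact: integ_coord.
have iG : integ (D i) G.
  have := integD iNj (integ_cst (D i) c).
  by apply: eq_integrable => // x _; rewrite /= NG subrK.
under eq_integral do rewrite NG.
have : \int[D i]_x (G x - c) = 0.
  rewrite RintegralB//; last exact: integ_cst.
  by rewrite Rintegral_prob_cst {1}/Rintegral Gc subrr.
rewrite /Rintegral => h; rewrite -[RHS]/(0%:E) -h fineK//.
by apply: integrable_fin_num => //; have := integB iG (integ_cst (D i) c).
Qed.

Lemma noise_u_mean i u v j : (\int[D i]_x (noise_u i u v x 0 j)%:E = 0)%E.
Proof.
have [h _] := F_unbiased i u v; have := h j; rewrite unlock.
apply: centered_mean (noise_u_var i u v) _.
  by apply: noise_u_measurable => //; exact: coord_measurable_cst.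
by move=> x; rewrite !mxE.
Qed.

Lemma noise_v_mean i u v j : (\int[D i]_x (noise_v i u v x 0 j)%:E = 0)%E.
Proof.
have [_ h] := F_unbiased i u v; have := h j; rewrite unlock.
apply: centered_mean (noise_v_var i u v) _.
  by apply: noise_v_measurable => //; exact: coord_measurable_cst.
by move=> x; rewrite !mxE.
Qed.

Context {dO : measure_display} {Omega : measurableType dO}.
Variable P : probability Omega R.
Variables (T K m : nat) (gamma_u gamma_v eta_u eta_v : R).
Variables (u0 : 'rV[R]_du) (v0 : 'I_n -> 'rV[R]_dv).
Variables (Sel : nat -> Omega -> {set 'I_n}).
Variables (xi : nat -> 'I_n -> nat -> {RV P >-> Xi}).
Hypothesis draws : fedavgp_draws D T K m Sel xi.

Local Notation index := ('I_T + 'I_T * 'I_n * 'I_K)%type.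
Local Notation history := (@history R dO dXi Omega Xi n P T K Sel xi).

Definition before_round (t : nat) : {set index} :=
  [set j : index | (match j with inl s => s < t | inr (s, _, _) => s < t end)%N]%SET.

Definition before_step (t : nat) (i : 'I_n) (k : nat) : {set index} :=
  [set j : index | (match j with inl s => s < t
    | inr (s, i', k') => (s < t) || [&& s == t :> nat, i' == i & k' < k] end)%N]%SET.

(* Contains the draws of the other clients in the whole of round [t], so that
   both the past of a noise increment and the noise of another client are
   measurable for it. *)
Definition other_draws (t : nat) (i : 'I_n) (k : nat) : {set index} :=
  [set j : index | (match j with inl s => s < t
    | inr (s, i', k') => (s < t) || (s == t :> nat) && ((i' != i) || (k' < k)) end)%N]%SET.

(** All samples of round [t] but not its selection: a round with prescribed set is measurable for
    these draws, and [Sel t] is independent of them. *)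
Definition before_selection (t : nat) : {set index} :=
  [set j : index | (match j with inl s => s < t | inr (s, _, _) => s <= t end)%N]%SET.

Let history_mono (J J' : {set index}) : J \subset J' -> <<s history J >> `<=` <<s history J' >>.
Proof. exact: history_sub. Qed.

Lemma before_round_sub_step t i k : before_round t \subset before_step t i k.
Proof.
by apply/fintype.subsetP => -[s|[[s i'] k']]; rewrite !inE //= => ->.
Qed.

Lemma before_step_mono t i k k' : (k <= k')%N ->
  before_step t i k \subset before_step t i k'.
Proof.
move=> kk'; apply/fintype.subsetP => -[s|[[s i'] l]]; rewrite !inE //=.
case: (s < t)%N => //= /and3P[-> -> lk] /=.
exact: leq_trans kk'.
Qed.

Lemma before_step_other t i k : before_step t i k \subset other_draws t i k.
Proof.
apply/fintype.subsetP => -[s|[[s i'] l]]; rewrite !inE //=.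
by case: (s < t)%N => //= /and3P[-> _ ->]; rewrite orbT.
Qed.

Lemma before_step_other_client t i i' k k' : i' != i ->
  before_step t i' k' \subset other_draws t i k.
Proof.
move=> ii'; apply/fintype.subsetP => -[s|[[s j] l]]; rewrite !inE //=.
by case: (s < t)%N => //= /and3P[-> /eqP -> _]; rewrite ii'.
Qed.

Lemma before_step_selection t i k : before_step t i k \subset before_selection t.
Proof.
apply/fintype.subsetP => -[s|[[s i'] l]]; rewrite !inE //=.
by case: ltnP => [/ltnW //|_] /= /and3P[/eqP -> _ _].
Qed.

Lemma before_selection_sub t : before_selection t \subset before_round t.+1.
Proof.
by apply/fintype.subsetP => -[s|[[s i'] l]]; rewrite !inE //= => /ltnW.
Qed.

Let W (t : nat) (w : Omega) :=
  fedavgp F m K gamma_u gamma_v eta_u eta_v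
    (fun s => Sel s w) (fun s i k => xi s i k w) (u0, v0) t.

(** Defined for every client, selected or not; thus it does not involve the selection of round
    [t]. *)
Let loc (t : nat) (i : 'I_n) (k : nat) (w : Omega) :=
  local_iter F gamma_u gamma_v (fun k => xi t i k w) ((W t w).1, (W t w).2 i) k.

Let N t i k w := noise_u i (loc t i k w).1 (loc t i k w).2 (xi t i k w).
Let N' t i k w := noise_v i (loc t i k w).1 (loc t i k w).2 (xi t i k w).

Let history_m (J : {set index}) : history J `<=` measurable.
Proof. exact: (history_measurable draws). Qed.

Let sqv_past (t : nat) (J : {set index}) :=
  sqv P (history J) (fun w => (W t w).1) /\
  forall i, sqv P (history J) (fun w => (W t w).2 i).

Let sqv_loc t i k (J : {set index}) :=
  sqv P (history J) (fun w => (loc t i k w).1) /\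
  sqv P (history J) (fun w => (loc t i k w).2).

Let sqv_mono (J J' : {set index}) d (U : Omega -> 'rV[R]_d) : J \subset J' ->
  sqv P (history J) U -> sqv P (history J') U.
Proof. by move=> JJ'; apply: sqv_sub; exact: history_mono. Qed.

Let other_notin (t : 'I_T) i (k : 'I_K) : inr (t, i, k) \notin other_draws t i k.
Proof. by rewrite inE ltnn eqxx /= eqxx ltnn. Qed.

Let xi_indep (t : 'I_T) i (k : 'I_K) A B :
  <<s history (other_draws t i k) >> A -> measurable B ->
  P (A `&` xi t i k @^-1` B) = (P A * D i B)%E.
Proof. exact: (history_indep_xi draws). Qed.

Let loc_next t i k w : loc t i k.+1 w =
  ((loc t i k w).1 - gamma_u *: (grad_fst (f i) (loc t i k w).1 (loc t i k w).2 + N t i k w),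
   (loc t i k w).2 - gamma_v *: (grad_snd (f i) (loc t i k w).1 (loc t i k w).2 + N' t i k w)).
Proof.
by rewrite /N /N' /noise_u /noise_v !subrKC.
Qed.

Let sqv_grad i (J : {set index}) U V : sqv P (history J) U -> sqv P (history J) V ->
  sqv P (history J) (fun w => grad_fst (f i) (U w) (V w)) /\
  sqv P (history J) (fun w => grad_snd (f i) (U w) (V w)).
Proof.
move=> hU hV; split.
- exact: (sqv_lipschitz (@history_m J) (grad_fst_lipschitz_fst f_smooth L_def L_gt0 i)
    (grad_fst_lipschitz_snd f_smooth L_def L_gt0 i) hU hV).
- exact: (sqv_lipschitz (@history_m J) (grad_snd_lipschitz_fst f_smooth L_def L_gt0 i)
    (grad_snd_lipschitz_snd f_smooth L_def L_gt0 i) hU hV).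
Qed.

(** The inductive link for square integrability: a square integrable iterate has square integrable
    noise because the variance bound is uniform, and the next iterate is a combination of the
    iterate, its gradient and this noise. *)
Let sqv_N (t : 'I_T) i (k : 'I_K) : sqv_loc t i k (before_step t i k) ->
  sqv P (history (before_step t i k.+1)) (N t i k) /\
  sqv P (history (before_step t i k.+1)) (N' t i k).
Proof.
move=> [h1 h2].
have indep A B : <<s history (before_step t i k) >> A -> measurable B ->
    P (A `&` xi t i k @^-1` B) = (P A * D i B)%E.
  by move=> hA; apply: xi_indep; exact: (history_mono (before_step_other t i k)).
have sub := history_mono (before_step_mono t i (leqnSn k)).
have mxi : measurable_fun (setT : set (g_sigma_algebraType (history (before_step t i k.+1))))
    (xi t i k : g_sigma_algebraType (history (before_step t i k.+1)) -> Xi).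
  by apply: measurable_history_xi; rewrite inE /= !eqxx ltnSn orbT.
split.
- exact: (sqv_noise (@history_m _) indep (noise_u_measurable i) (noise_u_var i)
    h1 h2 (@history_m _) sub mxi).
- exact: (sqv_noise (@history_m _) indep (noise_v_measurable i) (noise_v_var i)
    h1 h2 (@history_m _) sub mxi).
Qed.

Let sqv_loc_step (t : 'I_T) i k : (k <= K)%N -> sqv_past t (before_round t) ->
  sqv_loc t i k (before_step t i k).
Proof.
move=> kK [hu hv]; elim: k kK => [_|k IH kK].
  by split; apply: (sqv_mono (before_round_sub_step t i 0)); [exact: hu|exact: hv].
have hk := IH (ltnW kK); have [h1 h2] := hk.
have [n1 n2] := @sqv_N t i (Ordinal kK) hk.
have [g1 g2] := sqv_grad i h1 h2.
have sub := before_step_mono t i (leqnSn k).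
split; under eq_fun do rewrite loc_next /=.
- apply: sqvB => //; first exact: sqv_mono sub h1.
  by apply: sqvZ => //; apply: sqvD => //; exact: sqv_mono sub g1.
- apply: sqvB => //; first exact: sqv_mono sub h2.
  by apply: sqvZ => //; apply: sqvD => //; exact: sqv_mono sub g2.
Qed.

Let sqv_W t : (t <= T)%N -> sqv_past t (before_round t).
Proof.
elim: t => [_|t IH tT]; first by split=> [|i]; exact: sqv_cst.
have hW := IH (ltnW tT); have [hu hv] := hW.
have sub0 : before_round t \subset before_round t.+1.
  by apply/fintype.subsetP => -[s|[[s i'] l]]; rewrite !inE //= => /leqW.
have subK i : before_step t i K \subset before_round t.+1.
  exact: fintype.subset_trans (before_step_selection t i K) (before_selection_sub t).
have mSel i : measurable_fun (setT : set (g_sigma_algebraType (history (before_round t.+1))))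
    (fun w : g_sigma_algebraType (history (before_round t.+1)) => i \in Sel t w).
  apply: (@measurable_history_Sel _ _ _ _ _ _ _ _ _ _ _ _ _ _ (Ordinal tT)
    (fun A => i \in A)).
  by rewrite inE /= ltnSn.
have hloc i := @sqv_loc_step (Ordinal tT) i K (leqnn _) hW.
split=> [|i] /=.
- apply: sqvD => //; first by apply: sqvZ => //; exact: sqv_mono sub0 hu.
  apply: sqvZ => //; under eq_fun do rewrite big_mkcond.
  apply: sqv_sum => // i _; apply: sqv_if => //; last exact: sqv_cst.
  by have [h _] := hloc i; exact: sqv_mono (subK i) h.
- apply: sqv_if => //; last exact: sqv_mono sub0 (hv i).
  apply: sqvD => //; first by apply: sqvZ => //; exact: sqv_mono sub0 (hv i).
  by apply: sqvZ => //; have [_ h] := hloc i; exact: sqv_mono (subK i) h.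
Qed.


Let other_sqv (t : 'I_T) i (k : 'I_K) :
  sqv P (history (other_draws t i k)) (fun w => (loc t i k w).1) /\
  sqv P (history (other_draws t i k)) (fun w => (loc t i k w).2).
Proof.
have [h1 h2] := sqv_loc_step i (ltnW (ltn_ord k)) (sqv_W (ltnW (ltn_ord t))).
by split; [exact: sqv_mono (before_step_other t i k) h1
  |exact: sqv_mono (before_step_other t i k) h2].
Qed.

Let N_sqv (t : 'I_T) i k : (k < K)%N ->
  sqv P (history (before_step t i k.+1)) (N t i k) /\
  sqv P (history (before_step t i k.+1)) (N' t i k).
Proof.
move=> kK; apply: (@sqv_N t i (Ordinal kK)).
exact: sqv_loc_step (ltnW kK) (sqv_W (ltnW (ltn_ord t))).
Qed.

Let N_sq (t : 'I_T) i k : (k < K)%N ->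
  \int[P]_w sq (N t i k w) <= sigma_u ^+ 2 /\
  \int[P]_w sq (N' t i k w) <= sigma_v ^+ 2.
Proof.
move=> kK; have [h1 h2] := other_sqv t i (Ordinal kK).
have indep := @xi_indep t i (Ordinal kK); split.
- by have [] := noise_sq (@history_m _) indep (noise_u_measurable i)
    (noise_u_var i) h1 h2.
- by have [] := noise_sq (@history_m _) indep (noise_v_measurable i)
    (noise_v_var i) h1 h2.
Qed.

Let N_orth (t : 'I_T) i k (phi : Omega -> 'rV[R]_du) : (k < K)%N ->
  sqv P (history (other_draws t i k)) phi ->
  \int[P]_w dot (phi w) (N t i k w) = 0.
Proof.
move=> kK hphi; have [h1 h2] := other_sqv t i (Ordinal kK).
apply: (noise_orthogonal (@history_m _) (@xi_indep t i (Ordinal kK))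
  (noise_u_measurable i) (noise_u_mean i) (noise_u_var i) h1 h2 hphi).
have [hN _] := N_sqv t i kK.
exact: (sqv_dot (@history_m _) (@history_m _) hphi hN).
Qed.

Let N'_orth (t : 'I_T) i k (phi : Omega -> 'rV[R]_dv) : (k < K)%N ->
  sqv P (history (other_draws t i k)) phi ->
  \int[P]_w dot (phi w) (N' t i k w) = 0.
Proof.
move=> kK hphi; have [h1 h2] := other_sqv t i (Ordinal kK).
apply: (noise_orthogonal (@history_m _) (@xi_indep t i (Ordinal kK))
  (noise_v_measurable i) (noise_v_mean i) (noise_v_var i) h1 h2 hphi).
have [_ hN] := N_sqv t i kK.
exact: (sqv_dot (@history_m _) (@history_m _) hphi hN).
Qed.

Variables (gamma b : R).
Hypotheses (K_ge1 : (1 <= K)%N) (m_ge1 : (1 <= m)%N) (m_le_n : (m <= n)%N).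
Hypotheses (gamma_u_gt0 : 0 < gamma_u) (gamma_v_gt0 : 0 < gamma_v).
Hypotheses (eta_u_gt0 : 0 < eta_u) (eta_v_gt0 : 0 < eta_v).
Hypotheses (gamma_def_u : gamma = gamma_u * eta_u).
Hypotheses (gamma_def_v : gamma = gamma_v * eta_v).
Hypothesis eta_u_ge : Num.sqrt m%:R <= eta_u.
Hypothesis eta_v_ge : Num.sqrt (n%:R / m%:R) <= eta_v.
Hypothesis gamma_le : gamma <= (32 * L * K%:R)^-1.
Hypothesis f_dissim : bounded_dissimilarity F D b.

Let n_gt0 : 0 < n%:R :> R.
Proof. by rewrite ltr0n (leq_trans m_ge1). Qed.
Let m_gt0 : 0 < m%:R :> R.
Proof. by rewrite ltr0n. Qed.
Let gamma_gt0 : 0 < gamma.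
Proof. by rewrite gamma_def_u mulr_gt0. Qed.
Let kap_gt0 : 0 < K%:R :> R.
Proof. by rewrite ltr0n. Qed.

Let eta_u2 : m%:R <= eta_u ^+ 2.
Proof.
by rewrite -[leLHS]sqr_sqrtr ?ler_pXn2r ?nnegrE ?sqrtr_ge0 ?(ltW eta_u_gt0)// ltW.
Qed.

Let eta_v2 : n%:R / m%:R <= eta_v ^+ 2.
Proof.
have nm : 0 <= n%:R / m%:R :> R by rewrite divr_ge0.
by rewrite -[leLHS]sqr_sqrtr// ler_pXn2r ?nnegrE ?sqrtr_ge0 ?(ltW eta_v_gt0).
Qed.

(** This and the next bound are the form in which the lower bounds on [eta_u] and [eta_v] enter the
    estimates. *)
Let gamma_u2 : gamma_u ^+ 2 <= gamma ^+ 2 / m%:R.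
Proof.
by rewrite gamma_def_u exprMn ler_pdivlMr// ler_wpM2l ?sqr_ge0.
Qed.

Let gamma_v2 : gamma_v ^+ 2 <= gamma ^+ 2 * (m%:R / n%:R).
Proof.
rewrite gamma_def_v exprMn -mulrA ler_peMr ?sqr_ge0//.
apply: (@le_trans _ _ (n%:R / m%:R * (m%:R / n%:R))).
  by rewrite le_eqVlt; apply/orP; left; apply/eqP; field; rewrite !gt_eqF.
by rewrite ler_wpM2r ?divr_ge0.
Qed.

Let gamma_u_le : gamma_u <= gamma.
Proof.
rewrite -(@ler_pXn2r _ 2) ?nnegrE ?(ltW gamma_u_gt0) ?(ltW gamma_gt0)//.
apply: le_trans gamma_u2 _.
rewrite ler_pdivrMr// ler_peMr ?sqr_ge0//.
by rewrite ler1n.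
Qed.

Let gamma_v_le : gamma_v <= gamma.
Proof.
rewrite -(@ler_pXn2r _ 2) ?nnegrE ?(ltW gamma_v_gt0) ?(ltW gamma_gt0)//.
apply: le_trans gamma_v2 _.
rewrite ler_piMr ?sqr_ge0// ler_pdivrMr// mul1r ler_nat.
exact: m_le_n.
Qed.

(** * One round in expectation *)

Section Round.
Variable t : 'I_T.

Let g i w := grad_fst (f i) (W t w).1 ((W t w).2 i).
Let h i w := grad_snd (f i) (W t w).1 ((W t w).2 i).
Let gbar w := loss_grad_u F D (W t w).1 (W t w).2.
Let S := noise_sum (N t).
Let S' := noise_sum (N' t).
Let drift i k w := sq ((loc t i k w).1 - (loc t i 0 w).1)
  + sq ((loc t i k w).2 - (loc t i 0 w).2).
Let Er i w := \sum_(k < K) (grad_fst (f i) (loc t i k w).1 (loc t i k w).2 - g i w).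
Let Er' i w := \sum_(k < K) (grad_snd (f i) (loc t i k w).1 (loc t i k w).2 - h i w).
Let Q i w := \sum_(k < K) (gamma_u ^+ 2 * sq (S i k w) + gamma_v ^+ 2 * sq (S' i k w)).

Let next A w := fedavgp_round F m K gamma_u gamma_v eta_u eta_v A
  (fun i k => xi t i k w) (W t w).
(* Differences of iterates rather than multiples of gradient sums: the two agree
   only when [A] has [m] elements, and the selected set does so only almost surely. *)
Let dU A w := (next A w).1 - (W t w).1.
Let dV A i w := (next A w).2 i - (W t w).2 i.

(** The right-hand side of [loss_descent] for the round with prescribed set [A]. *)
Let X A w := dot (gbar w) (dU A w) + n%:R^-1 * (\sum_i dot (h i w) (dV A i w))
  + L * sq (dU A w) + L * (n%:R^-1 * \sum_i sq (dV A i w)).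

Let displacement i w :
  (loc t i K w).1 - (W t w).1 = - gamma_u *: (S i K w + (K%:R *: g i w + Er i w)) /\
  (loc t i K w).2 - (W t w).2 i = - gamma_v *: (S' i K w + (K%:R *: h i w + Er' i w)).
Proof.
have p1 k : (loc t i k.+1 w).1 = (loc t i k w).1 - gamma_u *:
    (grad_fst (f i) (loc t i k w).1 (loc t i k w).2 + N t i k w) by rewrite loc_next.
have p2 k : (loc t i k.+1 w).2 = (loc t i k w).2 - gamma_v *:
    (grad_snd (f i) (loc t i k w).1 (loc t i k w).2 + N' t i k w) by rewrite loc_next.
split.
- exact: (@displacementE _ _ K _ (fun k => (loc t i k w).1)
    (fun k => grad_fst (f i) (loc t i k w).1 (loc t i k w).2)
    (fun k => N t i k w) (g i w) p1).
- exact: (@displacementE _ _ K _ (fun k => (loc t i k w).2)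
    (fun k => grad_snd (f i) (loc t i k w).1 (loc t i k w).2)
    (fun k => N' t i k w) (h i w) p2).
Qed.

Let dUE (A : {set 'I_n}) w : #|A| = m ->
  dU A w = - (gamma / m%:R) *: \sum_(i in A) (S i K w + (K%:R *: g i w + Er i w)).
Proof.
move=> Am; rewrite /dU /next /fedavgp_round /=.
rewrite (eq_bigr (fun i => (W t w).1
    + - gamma_u *: (S i K w + (K%:R *: g i w + Er i w)))); last first.
  by move=> i _; have [<- _] := displacement i w; rewrite subrKC.
rewrite big_split /= sumr_const Am -scaler_sumr.
set Z := \sum_(i in A) _; rewrite -[(W t w).1 *+ m]scaler_nat.
apply/rowP => j; rewrite !mxE gamma_def_u.
by field; rewrite gt_eqF.
Qed.

Let dVE (A : {set 'I_n}) i w : dV A i w =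
  if i \in A then - gamma *: (S' i K w + (K%:R *: h i w + Er' i w)) else 0.
Proof.
rewrite /dV /next /fedavgp_round /=; case: (i \in A); last by rewrite subrr.
have [_ e] := displacement i w.
have -> : (local_iter F gamma_u gamma_v (fun k => xi t i k w)
    ((W t w).1, (W t w).2 i) K).2 = (W t w).2 i
    + - gamma_v *: (S' i K w + (K%:R *: h i w + Er' i w)) by rewrite -e subrKC.
by apply/rowP => j; rewrite !mxE gamma_def_v; ring.
Qed.

Let drift_ge0 i k w : 0 <= drift i k w.
Proof. by rewrite addr_ge0 ?sq_ge0. Qed.

Let gLk : gamma * (L * K%:R) <= 32^-1.
Proof.
have Lk0 : 0 < L * K%:R by rewrite mulr_gt0.
apply: le_trans (ler_wpM2r (ltW Lk0) gamma_le) _.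
rewrite le_eqVlt; apply/orP; left; apply/eqP.
by rewrite -mulrA invfM -mulrA mulVf ?mulr1// gt_eqF.
Qed.

Let round_bound w : subset_mean m (X^~ w) <=
  - gamma * dot (gbar w) (n%:R^-1 *: \sum_i S i K w)
  - gamma * (m%:R / n%:R ^+ 2 * \sum_i dot (h i w) (S' i K w))
  + 2 * L * gamma ^+ 2 * subset_mean m (fun A => sq (m%:R^-1 *: \sum_(i in A) S i K w))
  + 2 * L * gamma ^+ 2 * (m%:R / n%:R ^+ 2 * \sum_i sq (S' i K w))
  + 10 * gamma * L ^+ 2 * (n%:R^-1 * \sum_i Q i w)
  - gamma * K%:R / 4 * (sq (gbar w) + m%:R / n%:R ^+ 2 * \sum_i sq (h i w))
  + (8 * L * gamma ^+ 2 * K%:R ^+ 2 * (n%:R - m%:R) / (m%:R * n%:R) * b ^+ 2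
     + 20 * gamma * L ^+ 2 * K%:R ^+ 2 * (K%:R - 1) * gamma_u ^+ 2 * b ^+ 2).
Proof.
have gbarE : gbar w = n%:R^-1 *: \sum_i g i w by exact: (loss_grad_uE f_smooth).
rewrite (eq_subset_mean (psi := fun A =>
    dot (n%:R^-1 *: \sum_i g i w) (- (gamma / m%:R) *: \sum_(i in A)
      (S i K w + (K%:R *: g i w + Er i w)))
    + n%:R^-1 * (\sum_i dot (h i w) (if i \in A
        then - gamma *: (S' i K w + (K%:R *: h i w + Er' i w)) else 0))
    + L * sq (- (gamma / m%:R) *: \sum_(i in A)
      (S i K w + (K%:R *: g i w + Er i w)))
    + L * (n%:R^-1 * \sum_i sq (if i \in A
        then - gamma *: (S' i K w + (K%:R *: h i w + Er' i w)) else 0)))); last first.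
  move=> A Am; rewrite /X gbarE dUE//.
  by congr (_ + _ * _ + _ + _ * (_ * _)); apply: eq_bigr => i _; rewrite dVE.
rewrite gbarE.
have lip_u i k : sq (grad_fst (f i) (loc t i k w).1 (loc t i k w).2 - g i w)
    <= 2 * L ^+ 2 * drift i k w by exact: (grad_fst_lipschitz f_smooth L_def L_gt0).
have lip_v i k : sq (grad_snd (f i) (loc t i k w).1 (loc t i k w).2 - h i w)
    <= 2 * L ^+ 2 * drift i k w by exact: (grad_snd_lipschitz f_smooth L_def L_gt0).
have p1 i k : (loc t i k.+1 w).1 = (loc t i k w).1 - gamma_u *:
    (grad_fst (f i) (loc t i k w).1 (loc t i k w).2 + N t i k w) by rewrite loc_next.
have p2 i k : (loc t i k.+1 w).2 = (loc t i k w).2 - gamma_v *: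
    (grad_snd (f i) (loc t i k w).1 (loc t i k w).2 + N' t i k w) by rewrite loc_next.
have gu2 : gamma_u ^+ 2 <= gamma ^+ 2.
  by rewrite ler_pXn2r ?nnegrE ?(ltW gamma_u_gt0) ?(ltW gamma_gt0).
apply: (@subset_mean_round_le R n m du dv m_ge1 m_le_n L gamma gamma_u gamma_v K%:R b
  L_gt0 _ gamma_gt0 gLk gu2 gamma_v2 (g^~ w) (fun i => S i K w) (Er^~ w) (h^~ w)
  (fun i => S' i K w) (Er'^~ w) (Q^~ w) (fun i => \sum_(k < K) drift i k w)).
- by rewrite ler1n.
- have := f_dissim (W t w).1 (W t w).2; rewrite enorm_sqr -gbarE.
  by under eq_bigr do rewrite enorm_sqr.
- move=> i; have [e _] := @client_error_le R du dv K L
    (fun k => (loc t i k w).1) (fun k => grad_fst (f i) (loc t i k w).1 (loc t i k w).2)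
    (fun k => (loc t i k w).2) (fun k => grad_snd (f i) (loc t i k w).1 (loc t i k w).2)
    (g i w) (h i w) (lip_u i) (lip_v i).
  exact: e.
- move=> i; have [_ e] := @client_error_le R du dv K L
    (fun k => (loc t i k w).1) (fun k => grad_fst (f i) (loc t i k w).1 (loc t i k w).2)
    (fun k => (loc t i k w).2) (fun k => grad_snd (f i) (loc t i k w).1 (loc t i k w).2)
    (g i w) (h i w) (lip_u i) (lip_v i).
  exact: e.
- by move=> i; apply: sumr_ge0 => k _; exact: drift_ge0.
- move=> i; exact: (@client_drift_le R du dv K L gamma gamma_u gamma_v L_gt0 K_ge1
    (ltW gamma_u_gt0) (ltW gamma_v_gt0) gamma_u_le gamma_v_le gamma_le
    (fun k => (loc t i k w).1) (fun k => grad_fst (f i) (loc t i k w).1 (loc t i k w).2)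
    (fun k => N t i k w)
    (fun k => (loc t i k w).2) (fun k => grad_snd (f i) (loc t i k w).1 (loc t i k w).2)
    (fun k => N' t i k w)
    (g i w) (h i w) (p1 i) (p2 i) (lip_u i) (lip_v i)).
Qed.

Let loss_step w : loss F D (W t.+1 w).1 (W t.+1 w).2 - loss F D (W t w).1 (W t w).2 <=
  \sum_(A : {set 'I_n}) (Sel t w == A)%:R * X A w.
Proof.
have -> : \sum_(A : {set 'I_n}) (Sel t w == A)%:R * X A w = X (Sel t w) w.
  rewrite (bigD1 (Sel t w))//= eqxx mul1r big1 ?addr0//.
  by move=> A; rewrite eq_sym => /negbTE ->; rewrite mul0r.
exact: (@loss_descent R dXi Xi n du dv D F Lu Luv Lv Lvu L f_smooth L_def L_gt0
  (W t w).1 (next (Sel t w) w).1 (W t w).2 (next (Sel t w) w).2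
  (leq_trans m_ge1 m_le_n)).
Qed.

Let before_round_selection : before_round t \subset before_selection t.
Proof.
apply/fintype.subsetP => -[s|[[s i'] l]]; rewrite !inE //=.
exact: ltnW.
Qed.

Let C := history (before_selection t).

Let C_m : C `<=` measurable.
Proof. exact: history_m. Qed.

Let sqv_past_C : sqv_past t (before_selection t).
Proof.
have [h1 h2] := sqv_W (ltnW (ltn_ord t)).
split=> [|i]; first exact: sqv_mono before_round_selection h1.
exact: sqv_mono before_round_selection (h2 i).
Qed.

Let sqv_loc_C i k : (k <= K)%N -> sqv_loc t i k (before_selection t).
Proof.
move=> kK; have [h1 h2] := sqv_loc_step i kK (sqv_W (ltnW (ltn_ord t))).
by split; [exact: sqv_mono (before_step_selection t i k) h1
  |exact: sqv_mono (before_step_selection t i k) h2].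
Qed.

Let sqv_g i J : sqv_past t J -> sqv P (history J) (g i) /\ sqv P (history J) (h i).
Proof. by move=> [h1 h2]; exact: sqv_grad. Qed.

Let sqv_gbar J : sqv_past t J -> sqv P (history J) gbar.
Proof.
move=> hJ; have -> : gbar = fun w => n%:R^-1 *: \sum_i g i w.
  by apply/funext => w; exact: (loss_grad_uE f_smooth).
apply: sqvZ => //; apply: sqv_sum => // i _.
by have [] := sqv_g i hJ.
Qed.

Let sqv_dU A : sqv P C (dU A).
Proof.
have [h1 _] := sqv_past_C; apply: sqvB => //; rewrite /next /fedavgp_round /=.
apply: sqvD => //; first exact: sqvZ.
apply: sqvZ => //; apply: sqv_sum => // i _.
by have [] := sqv_loc_C i (leqnn K).
Qed.

Let sqv_dV A i : sqv P C (dV A i).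
Proof.
have [_ h2] := sqv_past_C; apply: sqvB => //; rewrite /next /fedavgp_round /=.
case: (i \in A); last exact: h2.
apply: sqvD => //; first exact: sqvZ.
by apply: sqvZ => //; have [] := sqv_loc_C i (leqnn K).
Qed.

Let measurable_X A : measurable_fun (setT : set (g_sigma_algebraType C))
  (X A : g_sigma_algebraType C -> R).
Proof.
have [mU _] := sqv_dU A; have [mg _] := sqv_gbar sqv_past_C.
have mV i : coord_measurable (dV A i : g_sigma_algebraType C -> 'rV[R]_dv).
  by have [] := sqv_dV A i.
have mh i : coord_measurable (h i : g_sigma_algebraType C -> 'rV[R]_dv).
  by have [_ []] := sqv_g i sqv_past_C.
apply: measurable_funD; first apply: measurable_funD; first apply: measurable_funD.
- exact: measurable_dot.
- apply: measurable_funM => //; apply: measurable_sum => i.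
  exact: measurable_dot.
- by apply: measurable_funM => //; exact: measurable_dot.
- apply: measurable_funM => //; apply: measurable_funM => //.
  by apply: measurable_sum => i; exact: measurable_dot.
Qed.

Let integ_X A : integ P (X A).
Proof.
have hC : C `<=` measurable by exact: history_m.
have hU := sqv_dU A; have hg := sqv_gbar sqv_past_C.
have hh i : sqv P C (h i) by have [] := sqv_g i sqv_past_C.
apply: integD; first apply: integD; first apply: integD.
- exact: sqv_dot hg hU.
- apply: integZ; apply: integ_sum => i _.
  exact: sqv_dot (hh i) (sqv_dV A i).
- by apply: integZ; exact: sqv_integ hU.
- apply: integZ; apply: integZ; apply: integ_sum => i _.
  exact: sqv_integ (sqv_dV A i).
Qed.

Let integ_selected : integ P (fun w => \sum_(A : {set 'I_n}) (Sel t w == A)%:R * X A w).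
Proof.
apply: integ_sum => A _.
have tC : inl t \notin before_selection t by rewrite inE /= ltnn.
by have [] := history_indep_Sel draws A tC (measurable_X A) (integ_X A).
Qed.

(** [X A] depends only on draws independent of the selection, so each indicator factors out as its
    probability. Sets whose size is not m get probability zero, so the values of [X] there are
    harmless. *)
Let expectation_selected :
  \int[P]_w (\sum_(A : {set 'I_n}) (Sel t w == A)%:R * X A w) =
  \int[P]_w subset_mean m (X^~ w).
Proof.
have tC : inl t \notin before_selection t by rewrite inE /= ltnn.
have hS A := history_indep_Sel draws A tC (measurable_X A) (integ_X A).
rewrite Rintegral_sum; last by move=> A _; have [] := hS A.
rewrite /subset_mean RintegralZl//; last by apply: integ_sum.
rewrite Rintegral_sum// mulr_sumr [RHS]big_mkcond /=; apply: eq_bigr => A _.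
have [_ ->] := hS A.
by case: (#|A| == m); rewrite ?mul0r.
Qed.

Let step_mono i k k' : (k <= k')%N ->
  <<s history (before_step t i k) >> `<=` <<s history (before_step t i k') >>.
Proof. by move=> kk'; apply: history_mono; exact: before_step_mono. Qed.

Let step_m i k : history (before_step t i k) `<=` measurable.
Proof. exact: history_m. Qed.

Let step_other i k :
  <<s history (before_step t i k) >> `<=` <<s history (other_draws t i k) >>.
Proof. by apply: history_mono; exact: before_step_other. Qed.

Let step_other_client i i' k k' : i' != i ->
  <<s history (before_step t i' k') >> `<=` <<s history (other_draws t i k) >>.
Proof. by move=> ii'; apply: history_mono; exact: before_step_other_client. Qed.

Let round_step i :
  <<s history (before_round t) >> `<=` <<s history (before_step t i 0) >>.
Proof. by apply: history_mono; exact: before_round_sub_step. Qed.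

Let N1_sqv i k (kK : (k < K)%N) := (N_sqv t i kK).1.
Let N1'_sqv i k (kK : (k < K)%N) := (N_sqv t i kK).2.
Let N1_sq i k (kK : (k < K)%N) := (N_sq t i kK).1.
Let N1'_sq i k (kK : (k < K)%N) := (N_sq t i kK).2.

Let S_orth i phi : sqv P (history (before_round t)) phi ->
  \int[P]_w dot (phi w) (S i K w) = 0.
Proof.
exact: (noise_sum_past (@history_m _) step_m round_step step_mono step_other
  N1_sqv (@N_orth t) i (leqnn K)).
Qed.

Let S'_orth i phi : sqv P (history (before_round t)) phi ->
  \int[P]_w dot (phi w) (S' i K w) = 0.
Proof.
exact: (noise_sum_past (@history_m _) step_m round_step step_mono step_other
  N1'_sqv (@N'_orth t) i (leqnn K)).
Qed.

Let S_sq i k (kK : (k <= K)%N) : \int[P]_w sq (S i k w) <= k%:R * sigma_u ^+ 2.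
Proof. exact: (noise_sum_sq_le step_m step_mono step_other N1_sqv N1_sq (@N_orth t)). Qed.

Let S'_sq i k (kK : (k <= K)%N) : \int[P]_w sq (S' i k w) <= k%:R * sigma_v ^+ 2.
Proof. exact: (noise_sum_sq_le step_m step_mono step_other N1'_sqv N1'_sq (@N'_orth t)). Qed.

Let S_mean_sq (A : {set 'I_n}) : #|A| = m ->
  \int[P]_w sq (m%:R^-1 *: \sum_(i in A) S i K w) <= K%:R * sigma_u ^+ 2 / m%:R.
Proof.
exact: (noise_sum_mean_sq_le step_m step_mono step_other step_other_client
  N1_sqv N1_sq (@N_orth t) m_ge1).
Qed.

Let hS i k (kK : (k <= K)%N) :
  sqv P (history (before_step t i k)) (S i k) := noise_sum_sqv step_m step_mono N1_sqv i kK.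
Let hS' i k (kK : (k <= K)%N) :
  sqv P (history (before_step t i k)) (S' i k) := noise_sum_sqv step_m step_mono N1'_sqv i kK.

Let hS_C i : sqv P C (S i K).
Proof. exact: sqv_mono (before_step_selection t i K) (hS i (leqnn K)). Qed.

Let past_t : sqv_past t (before_round t). Proof. exact/sqv_W/ltnW/ltn_ord. Qed.

(** The random terms of [round_bound]: [Y1] and [Y2] are linear in the noise and have mean zero,
    [Y3] to [Y5] are quadratic in it, and [Y6] collects the gradient norms to be estimated. *)
Let Y1 w := dot (gbar w) (n%:R^-1 *: \sum_i S i K w).
Let Y2 w := \sum_i dot (h i w) (S' i K w).
Let Y3 w := subset_mean m (fun A => sq (m%:R^-1 *: \sum_(i in A) S i K w)).
Let Y4 w := \sum_i sq (S' i K w).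
Let Y5 w := \sum_i Q i w.
Let Y6 w := sq (gbar w) + m%:R / n%:R ^+ 2 * \sum_i sq (h i w).

Let Y1_mean : integ P Y1 /\ \int[P]_w Y1 w = 0.
Proof.
have hg := sqv_gbar past_t.
have iS i : integ P (fun w => dot (gbar w) (S i K w)).
  by apply: sqv_dot hg (hS i (leqnn K)) => //; exact: history_m.
have -> : Y1 = fun w => n%:R^-1 * \sum_i dot (gbar w) (S i K w).
  by apply/funext => w; rewrite /Y1 dotZr dot_sumr.
split; first by apply: integZ; exact: integ_sum.
rewrite RintegralZl//; last exact: integ_sum.
by rewrite Rintegral_sum// big1 ?mulr0// => i _; exact: S_orth.
Qed.

Let Y2_mean : integ P Y2 /\ \int[P]_w Y2 w = 0.
Proof.
have hh i : sqv P (history (before_round t)) (h i) by have [] := sqv_g i past_t.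
have iS i : integ P (fun w => dot (h i w) (S' i K w)).
  by apply: sqv_dot (hh i) (hS' i (leqnn K)) => //; exact: history_m.
split; first exact: integ_sum.
by rewrite Rintegral_sum// big1// => i _; exact: S'_orth.
Qed.

Let Y3_mean : integ P Y3 /\ \int[P]_w Y3 w <= K%:R * sigma_u ^+ 2 / m%:R.
Proof.
have iS (A : {set 'I_n}) : integ P (fun w => sq (m%:R^-1 *: \sum_(i in A) S i K w)).
  apply: (@sqv_integ _ _ _ _ C).
  by apply: sqvZ => //; apply: sqv_sum.
split; first by apply: integZ; exact: integ_sum.
rewrite /Y3 /subset_mean RintegralZl//; last exact: integ_sum.
rewrite Rintegral_sum// -[leRHS](@subset_mean_cst R n m m_le_n).
exact: le_subset_mean.
Qed.

Let Y4_mean : integ P Y4 /\ \int[P]_w Y4 w <= n%:R * (K%:R * sigma_v ^+ 2).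
Proof.
have iS i : integ P (fun w => sq (S' i K w)) by exact: sqv_integ (hS' i (leqnn K)).
split; first exact: integ_sum.
rewrite Rintegral_sum//; apply: le_trans (ler_sum _ (fun i _ => S'_sq i (leqnn K))) _.
by rewrite sumr_const card_ord -[_ *+ n]mulr_natl.
Qed.

Let Y5_mean : integ P Y5 /\ \int[P]_w Y5 w <=
  n%:R * (K%:R ^+ 2 * (gamma_u ^+ 2 * sigma_u ^+ 2 + gamma_v ^+ 2 * sigma_v ^+ 2)).
Proof.
have iS i (k : 'I_K) : integ P (fun w => sq (S i k w)).
  exact: sqv_integ (hS i (ltnW (ltn_ord k))).
have iS' i (k : 'I_K) : integ P (fun w => sq (S' i k w)).
  exact: sqv_integ (hS' i (ltnW (ltn_ord k))).
have iq i (k : 'I_K) : integ P (fun w => gamma_u ^+ 2 * sq (S i k w)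
    + gamma_v ^+ 2 * sq (S' i k w)).
  by apply: integD; exact: integZ.
have iQ i : integ P (Q i) by exact: integ_sum.
split; first exact: integ_sum.
rewrite Rintegral_sum//.
set c := K%:R ^+ 2 * _.
have -> : n%:R * c = \sum_(i < n) c by rewrite sumr_const card_ord mulr_natl.
apply: ler_sum => i _; rewrite Rintegral_sum//.
have -> : c = \sum_(k < K) K%:R * (gamma_u ^+ 2 * sigma_u ^+ 2 + gamma_v ^+ 2 * sigma_v ^+ 2).
  by rewrite sumr_const card_ord /c expr2 -mulrA mulr_natl.
apply: ler_sum => k _.
rewrite RintegralD//; [|exact: integZ|exact: integZ].
rewrite (RintegralZl _ measurableT (iS i k)) (RintegralZl _ measurableT (iS' i k)).
rewrite mulrDr; apply: lerD; rewrite mulrCA ler_wpM2l ?sqr_ge0//.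
- apply: le_trans (S_sq i (ltnW (ltn_ord k))) _.
  by rewrite ler_wpM2r ?sqr_ge0// ler_nat ltnW.
- apply: le_trans (S'_sq i (ltnW (ltn_ord k))) _.
  by rewrite ler_wpM2r ?sqr_ge0// ler_nat ltnW.
Qed.

Let integ_h i : integ P (fun w => sq (h i w)).
Proof. by have [_ hh] := sqv_g i past_t; exact: sqv_integ hh. Qed.

Let integ_gbar : integ P (fun w => sq (gbar w)).
Proof. exact: sqv_integ (sqv_gbar past_t). Qed.

Let Y6_mean : integ P Y6 /\ \int[P]_w Y6 w =
  \int[P]_w sq (gbar w) + m%:R / n%:R ^+ 2 * \sum_i \int[P]_w sq (h i w).
Proof.
have ihs : integ P (fun w => \sum_i sq (h i w)) by exact: integ_sum.
split; first by apply: integD => //; exact: integZ.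
by rewrite RintegralD//; [rewrite RintegralZl// Rintegral_sum|exact: integZ].
Qed.

Let expectation_round : \int[P]_w subset_mean m (X^~ w) <=
  - (gamma * K%:R / 4) * (\int[P]_w sq (gbar w)
     + m%:R / n%:R ^+ 2 * \sum_i \int[P]_w sq (h i w))
  + (2 * L * gamma ^+ 2 * (K%:R * sigma_u ^+ 2 / m%:R)
     + 2 * L * gamma ^+ 2 * (m%:R / n%:R ^+ 2 * (n%:R * (K%:R * sigma_v ^+ 2)))
     + 10 * gamma * L ^+ 2 * (n%:R^-1 * (n%:R * (K%:R ^+ 2
        * (gamma_u ^+ 2 * sigma_u ^+ 2 + gamma_v ^+ 2 * sigma_v ^+ 2))))
     + (8 * L * gamma ^+ 2 * K%:R ^+ 2 * (n%:R - m%:R) / (m%:R * n%:R) * b ^+ 2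
     + 20 * gamma * L ^+ 2 * K%:R ^+ 2 * (K%:R - 1) * gamma_u ^+ 2 * b ^+ 2)).
Proof.
have [i1 e1] := Y1_mean; have [i2 e2] := Y2_mean; have [i3 e3] := Y3_mean.
have [i4 e4] := Y4_mean; have [i5 e5] := Y5_mean; have [i6 e6] := Y6_mean.
set c := 8 * L * gamma ^+ 2 * K%:R ^+ 2 * _ / _ * _ + _.
pose Z w := - gamma * Y1 w + (- (gamma * (m%:R / n%:R ^+ 2)) * Y2 w
  + (2 * L * gamma ^+ 2 * Y3 w + (2 * L * gamma ^+ 2 * (m%:R / n%:R ^+ 2) * Y4 w
  + (10 * gamma * L ^+ 2 * n%:R^-1 * Y5 w + (- (gamma * K%:R / 4) * Y6 w + c))))).
apply: (@le_trans _ _ (\int[P]_w Z w)).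
  apply: le_Rintegral => //.
  - by apply: integZ; apply: integ_sum => A _; exact: integ_X.
  - by do ![done|exact: integ_cst|apply: integZ|apply: integD].
  - move=> w _; apply: le_trans (round_bound w) _.
    rewrite -/(Y1 w) -/(Y2 w) -/(Y3 w) -/(Y4 w) -/(Y5 w) -/(Y6 w) -/c.
    by rewrite le_eqVlt; apply/orP; left; apply/eqP; rewrite /Z; ring.
have Lg : 0 <= 2 * L * gamma ^+ 2 by rewrite !mulr_ge0 ?sqr_ge0// ltW.
have -> : \int[P]_w Z w = - gamma * \int[P]_w Y1 w
  + (- (gamma * (m%:R / n%:R ^+ 2)) * \int[P]_w Y2 w
  + (2 * L * gamma ^+ 2 * \int[P]_w Y3 w
  + (2 * L * gamma ^+ 2 * (m%:R / n%:R ^+ 2) * \int[P]_w Y4 w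
  + (10 * gamma * L ^+ 2 * n%:R^-1 * \int[P]_w Y5 w
  + (- (gamma * K%:R / 4) * \int[P]_w Y6 w + c))))).
  rewrite /Z; do 6![rewrite RintegralD//; last first;
    [by do ![done|exact: integ_cst|apply: integZ|apply: integD]|
     by do ![done|exact: integ_cst|apply: integZ|apply: integD]|
     rewrite RintegralZl//; congr (_ + _)]].
  by rewrite Rintegral_prob_cst.
rewrite e1 e2 e6 !mulr0 !add0r.
have e3' := ler_wpM2l Lg e3.
have mn : 0 <= 2 * L * gamma ^+ 2 * (m%:R / n%:R ^+ 2).
  by rewrite mulr_ge0// divr_ge0 ?sqr_ge0.
have e4' := ler_wpM2l mn e4.
have gn : 0 <= 10 * gamma * L ^+ 2 * n%:R^-1.
  by rewrite !mulr_ge0 ?sqr_ge0 ?invr_ge0// ltW.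
have e5' := ler_wpM2l gn e5.
move: e3' e4' e5'; rewrite !mulrA => e3' e4' e5'.
by lra.
Qed.

Let error : R := 12 * L * (4 * (n%:R - m%:R) * K%:R * b ^+ 2 / (m%:R * n%:R)
    + sigma_u ^+ 2 / m%:R + m%:R * sigma_v ^+ 2 / n%:R) * gamma
  + 128 * L ^+ 2 * K%:R * (K%:R - 1) * b ^+ 2 / eta_u ^+ 2 * gamma ^+ 2.

(** In the units [xu], [xv], [xb], [xd], the left side is at most 3, 3, 8, 20 and the right side is
    3, 3, 12, 32. The third unit of [xu] and [xv] pays for the noise in the drift, because 10 gamma
    L K <= 10/32. *)
Let round_error_le : 2 * L * gamma ^+ 2 * (K%:R * sigma_u ^+ 2 / m%:R)
     + 2 * L * gamma ^+ 2 * (m%:R / n%:R ^+ 2 * (n%:R * (K%:R * sigma_v ^+ 2)))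
     + 10 * gamma * L ^+ 2 * (n%:R^-1 * (n%:R * (K%:R ^+ 2
        * (gamma_u ^+ 2 * sigma_u ^+ 2 + gamma_v ^+ 2 * sigma_v ^+ 2))))
     + (8 * L * gamma ^+ 2 * K%:R ^+ 2 * (n%:R - m%:R) / (m%:R * n%:R) * b ^+ 2
     + 20 * gamma * L ^+ 2 * K%:R ^+ 2 * (K%:R - 1) * gamma_u ^+ 2 * b ^+ 2)
  <= gamma * K%:R / 4 * error.
Proof.
set kap : R := K%:R.
have k0 : 0 < kap := kap_gt0.
have k1 : 0 <= kap - 1 by rewrite subr_ge0 ler1n.
pose xu := L * gamma ^+ 2 * kap * (sigma_u ^+ 2 / m%:R).
pose xv := L * gamma ^+ 2 * kap * (m%:R / n%:R * sigma_v ^+ 2).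
pose xb := L * gamma ^+ 2 * kap ^+ 2 * ((n%:R - m%:R) / (m%:R * n%:R)) * b ^+ 2.
pose xd := gamma * L ^+ 2 * kap ^+ 2 * (kap - 1) * gamma_u ^+ 2 * b ^+ 2.
have Lg0 : 0 <= L * gamma ^+ 2 * kap by do ![done|exact: ltW|apply: mulr_ge0].
have xu0 : 0 <= xu by rewrite mulr_ge0// divr_ge0 ?sqr_ge0.
have xv0 : 0 <= xv by rewrite mulr_ge0// mulr_ge0 ?divr_ge0 ?sqr_ge0.
have mn0 : 0 <= n%:R - m%:R :> R by rewrite subr_ge0 ler_nat.
have xb0 : 0 <= xb.
  have := divr_ge0 mn0 (mulr_ge0 (ltW m_gt0) (ltW n_gt0)) => h0.
  by do ![done|exact: ltW|exact: sqr_ge0|apply: mulr_ge0].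
have xd0 : 0 <= xd by do ![done|exact: ltW|exact: sqr_ge0|apply: mulr_ge0].
(* The denominator eta_u^2 of the last error term arises from gamma_u^2 = gamma^2 / eta_u^2. *)
have errE : gamma * kap / 4 * error = 3 * xu + 3 * xv + 12 * xb + 32 * xd.
  rewrite /error /xu /xv /xb /xd gamma_def_u -/kap.
  by field; rewrite !gt_eqF.
have noise_le : 10 * gamma * L ^+ 2 * kap ^+ 2
    * (gamma_u ^+ 2 * sigma_u ^+ 2 + gamma_v ^+ 2 * sigma_v ^+ 2) <= xu + xv.
  have c0 : 0 <= 10 * gamma * L ^+ 2 * kap ^+ 2.
    by do ![done|exact: ltW|exact: sqr_ge0|apply: mulr_ge0].
  apply: (@le_trans _ _ (10 * gamma * L ^+ 2 * kap ^+ 2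
      * (gamma ^+ 2 / m%:R * sigma_u ^+ 2 + gamma ^+ 2 * (m%:R / n%:R) * sigma_v ^+ 2))).
    by apply: ler_wpM2l => //; apply: lerD; rewrite ler_wpM2r ?sqr_ge0.
  have -> : 10 * gamma * L ^+ 2 * kap ^+ 2
      * (gamma ^+ 2 / m%:R * sigma_u ^+ 2 + gamma ^+ 2 * (m%:R / n%:R) * sigma_v ^+ 2)
      = 10 * (gamma * (L * kap)) * (xu + xv).
    by rewrite /xu /xv; field; rewrite !gt_eqF.
  rewrite ler_piMl ?addr_ge0//.
  by move: gLk; rewrite -/kap; lra.
rewrite errE.
have -> : 2 * L * gamma ^+ 2 * (kap * sigma_u ^+ 2 / m%:R) = 2 * xu.
  by rewrite /xu; ring.
have -> : 2 * L * gamma ^+ 2 * (m%:R / n%:R ^+ 2 * (n%:R * (kap * sigma_v ^+ 2))) = 2 * xv.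
  by rewrite /xv; field; rewrite gt_eqF.
have -> : 10 * gamma * L ^+ 2 * (n%:R^-1 * (n%:R * (kap ^+ 2
    * (gamma_u ^+ 2 * sigma_u ^+ 2 + gamma_v ^+ 2 * sigma_v ^+ 2)))) =
    10 * gamma * L ^+ 2 * kap ^+ 2
    * (gamma_u ^+ 2 * sigma_u ^+ 2 + gamma_v ^+ 2 * sigma_v ^+ 2).
  by rewrite mulKf ?gt_eqF// !mulrA.
have -> : 8 * L * gamma ^+ 2 * kap ^+ 2 * (n%:R - m%:R) / (m%:R * n%:R) * b ^+ 2 = 8 * xb.
  by rewrite /xb; ring.
have -> : 20 * gamma * L ^+ 2 * kap ^+ 2 * (kap - 1) * gamma_u ^+ 2 * b ^+ 2 = 20 * xd.
  by rewrite /xd; ring.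
by lra.
Qed.

Lemma fedavgp_round_descent :
  [/\ integ P (fun w => sq (gbar w)), forall i, integ P (fun w => sq (h i w)) &
    exists Y : Omega -> R, [/\ integ P Y,
      forall w, loss F D (W t.+1 w).1 (W t.+1 w).2 - loss F D (W t w).1 (W t w).2 <= Y w &
      \int[P]_w Y w <= - (gamma * K%:R / 4) * (\int[P]_w sq (gbar w)
        + m%:R / n%:R ^+ 2 * \sum_i \int[P]_w sq (h i w))
        + gamma * K%:R / 4 * error]].
Proof.
split; [exact: integ_gbar|exact: integ_h|].
exists (fun w => \sum_(A : {set 'I_n}) (Sel t w == A)%:R * X A w).
split; [exact: integ_selected|exact: loss_step|].
rewrite expectation_selected; apply: le_trans expectation_round _.
by rewrite lerD2l.
Qed.

End Round.

(** An arbitrary real lower bound [r] stands for the infimum, so that everything here stays in the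
    reals. *)
Lemma fedavgp_mean_gradient_le (r : R) : (1 <= T)%N ->
  (forall u v, r <= loss F D u v) ->
  T%:R^-1 * \sum_(t < T) (\int[P]_w sq (loss_grad_u F D (W t w).1 (W t w).2)
    + m%:R / n%:R ^+ 2 * \sum_i \int[P]_w sq (grad_snd (f i) (W t w).1 ((W t w).2 i))) <=
  4 / (T%:R * K%:R * gamma) * (loss F D u0 v0 - r)
  + (12 * L * (4 * (n%:R - m%:R) * K%:R * b ^+ 2 / (m%:R * n%:R)
    + sigma_u ^+ 2 / m%:R + m%:R * sigma_v ^+ 2 / n%:R) * gamma
  + 128 * L ^+ 2 * K%:R * (K%:R - 1) * b ^+ 2 / eta_u ^+ 2 * gamma ^+ 2).
Proof.
move=> T1 hr; set err := _ * gamma + _ * gamma ^+ 2.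
pose G (t : 'I_T) := \int[P]_w sq (loss_grad_u F D (W t w).1 (W t w).2)
    + m%:R / n%:R ^+ 2 * \sum_i \int[P]_w sq (grad_snd (f i) (W t w).1 ((W t w).2 i)).
have /choice[Y hY] (t : 'I_T) : exists Y : Omega -> R, [/\ integ P Y,
      forall w, loss F D (W t.+1 w).1 (W t.+1 w).2 - loss F D (W t w).1 (W t w).2 <= Y w &
      \int[P]_w Y w <= - (gamma * K%:R / 4) * G t + gamma * K%:R / 4 * err].
  by have [_ _ e] := fedavgp_round_descent t.
have iY t : integ P (Y t) by have [] := hY t.
have T0 : 0 < T%:R :> R by rewrite ltr0n.
(* After telescoping at each outcome, the final loss is replaced by [r]: on the loss side only a
   constant is integrated. *)
have sumY : r - loss F D u0 v0 <= \sum_(t < T) \int[P]_w Y t w.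
  rewrite -Rintegral_sum// -[leLHS](Rintegral_prob_cst P); apply: le_Rintegral => //.
  - exact: integ_cst.
  - exact: integ_sum.
  - move=> w _; apply: (@le_trans _ _ (\sum_(t < T)
        (loss F D (W t.+1 w).1 (W t.+1 w).2 - loss F D (W t w).1 (W t w).2))).
      rewrite -(big_mkord xpredT (fun t => loss F D (W t.+1 w).1 (W t.+1 w).2
        - loss F D (W t w).1 (W t w).2)).
      by rewrite telescope_sumr// lerD2r.
    by apply: ler_sum => t _; have [_ + _] := hY t; apply.
have sumG : \sum_(t < T) \int[P]_w Y t w <= - (gamma * K%:R / 4) * (\sum_(t < T) G t)
    + T%:R * (gamma * K%:R / 4 * err).
  have -> : T%:R * (gamma * K%:R / 4 * err) = \sum_(t < T) gamma * K%:R / 4 * err.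
    by rewrite sumr_const card_ord mulr_natl.
  by rewrite mulr_sumr -big_split; apply: ler_sum => t _; have [] := hY t.
have gk : 0 < gamma * K%:R / 4 by rewrite divr_gt0// mulr_gt0.
have h1 : gamma * K%:R / 4 * (\sum_(t < T) G t) <=
    loss F D u0 v0 - r + T%:R * (gamma * K%:R / 4 * err) by lra.
rewrite -(ler_pM2l (mulr_gt0 T0 gk)).
have -> : T%:R * (gamma * K%:R / 4) * (T%:R^-1 * \sum_(t < T) G t) =
    gamma * K%:R / 4 * (\sum_(t < T) G t) by field; rewrite gt_eqF.
apply: le_trans h1 _; rewrite le_eqVlt; apply/orP; left; apply/eqP.
by field; rewrite !gt_eqF.
Qed.

End GradientNoise.

Unset Implicit Arguments.
Set Strict Implicit.
Set Printing Implicit Defensive.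

Theorem theorem3p7
  (R : realType) (dO dXi : measure_display)
  (Omega : measurableType dO) (Xi : measurableType dXi)
  (P : probability Omega R)
  (n du dv : nat)
  (D : 'I_n -> probability Xi R)
  (F : 'rV[R]_du -> 'rV[R]_dv -> Xi -> R)
  (Lu Luv Lv Lvu L sigma_u sigma_v b : R)
  (T K m : nat) (gamma_u gamma_v eta_u eta_v gamma : R)
  (u0 : 'rV[R]_du) (v0 : 'I_n -> 'rV[R]_dv)
  (Sel : nat -> Omega -> {set 'I_n})
  (xi : nat -> 'I_n -> nat -> {RV P >-> Xi})
  (F_diff : forall x, partially_differentiable (fun u v => F u v x))
  (F_int : forall i u v, (D i).-integrable setT (EFin \o F u v))
  (f_smooth : smoothness F D Lu Luv Lv Lvu)
  (L_def : L = Num.max (Num.max Lu Lv) (Num.max Luv Lvu))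
  (L_gt0 : 0 < L)
  (F_unbiased : unbiased_gradients F D)
  (F_variance : bounded_variance F D sigma_u sigma_v)
  (b_gt0 : 0 < b)
  (f_dissim : bounded_dissimilarity F D b)
  (T_ge1 : (1 <= T)%N) (K_ge1 : (1 <= K)%N)
  (m_ge1 : (1 <= m)%N) (m_le_n : (m <= n)%N)
  (gamma_u_gt0 : 0 < gamma_u) (gamma_v_gt0 : 0 < gamma_v)
  (eta_u_gt0 : 0 < eta_u) (eta_v_gt0 : 0 < eta_v)
  (gamma_def_u : gamma = gamma_u * eta_u)
  (gamma_def_v : gamma = gamma_v * eta_v)
  (draws : fedavgp_draws D T K m Sel xi)
  (eta_u_ge : Num.sqrt m%:R <= eta_u)
  (eta_v_ge : Num.sqrt (n%:R / m%:R) <= eta_v)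
  (gamma_le : gamma <= (32 * L * K%:R)^-1) :
  let w (t : nat) (omega : Omega) :=
    fedavgp F m K gamma_u gamma_v eta_u eta_v
      (fun s => Sel s omega) (fun s i k => xi s i k omega) (u0, v0) t in
  let G_u (t : nat) : \bar R :=
    'E_P[fun omega =>
           (enorm (loss_grad_u F D (w t omega).1 (w t omega).2) ^+ 2)%R]%E in
  let G_v (t : nat) : \bar R :=
    ((m%:R / n%:R ^+ 2)%:E * \sum_(i < n)
       'E_P[fun omega =>
                (enorm (grad_snd (local_loss F D i)
                          (w t omega).1 ((w t omega).2 i)) ^+ 2)%R])%E in
  ((T%:R^-1)%:E * \sum_(t < T) (G_u t + G_v t) <=
     (4 / (T%:R * K%:R * gamma))%:E * optimality_gap F D u0 v0
     + (12 * L * (4 * (n%:R - m%:R) * K%:R * b ^+ 2 / (m%:R * n%:R)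
                  + sigma_u ^+ 2 / m%:R + m%:R * sigma_v ^+ 2 / n%:R) * gamma
        + 128 * L ^+ 2 * K%:R * (K%:R - 1) * b ^+ 2 / eta_u ^+ 2
          * gamma ^+ 2)%:E)%E.
Proof.
cbv zeta; pose w t omega := fedavgp F m K gamma_u gamma_v eta_u eta_v
  (fun s => Sel s omega) (fun s i k => xi s i k omega) (u0, v0) t.
have mean_le r := @fedavgp_mean_gradient_le R dXi Xi n du dv D F Lu Luv Lv Lvu L
  sigma_u sigma_v F_diff F_int f_smooth L_def L_gt0 F_unbiased F_variance dO Omega P
  T K m gamma_u gamma_v eta_u eta_v u0 v0 Sel xi draws gamma b K_ge1 m_ge1 m_le_n
  gamma_u_gt0 gamma_v_gt0 eta_u_gt0 eta_v_gt0 gamma_def_u gamma_def_v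
  eta_u_ge eta_v_ge gamma_le f_dissim r T_ge1.
have descent := @fedavgp_round_descent R dXi Xi n du dv D F Lu Luv Lv Lvu L
  sigma_u sigma_v F_diff F_int f_smooth L_def L_gt0 F_unbiased F_variance dO Omega P
  T K m gamma_u gamma_v eta_u eta_v u0 v0 Sel xi draws gamma b K_ge1 m_ge1 m_le_n
  gamma_u_gt0 gamma_v_gt0 eta_u_gt0 eta_v_gt0 gamma_def_u gamma_def_v
  eta_u_ge eta_v_ge gamma_le f_dissim.
have expectation_sq d (V : Omega -> 'rV[R]_d) : integ P (fun x => sq (V x)) ->
    'E_P[fun x => (enorm (V x) ^+ 2)%R]%E = (\int[P]_x sq (V x))%:E.
  move=> iV; rewrite unlock /Rintegral fineK; last exact: integrable_fin_num.
  by apply: eq_integral => x _; rewrite enorm_sqr.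
have GE (t : 'I_T) :
    ('E_P[fun omega => (enorm (loss_grad_u F D (w t omega).1 (w t omega).2) ^+ 2)%R]
    + (m%:R / n%:R ^+ 2)%:E * \sum_(i < n) 'E_P[fun omega =>
      (enorm (grad_snd (local_loss F D i) (w t omega).1 ((w t omega).2 i)) ^+ 2)%R])%E =
    (\int[P]_x sq (loss_grad_u F D (w t x).1 (w t x).2) + m%:R / n%:R ^+ 2
     * \sum_i \int[P]_x sq (grad_snd (local_loss F D i) (w t x).1 ((w t x).2 i)))%:E.
  have [iU iV _] := descent t.
  by rewrite expectation_sq// (eq_bigr _ (fun i _ => expectation_sq _ _ (iV i)))
    sumEFin -EFinM -EFinD.
rewrite (eq_bigr _ (fun t _ => GE t)) sumEFin -EFinM /optimality_gap.
set E := ereal_inf _.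
have E_le u v : (E <= (loss F D u v)%:E)%E.
  by apply: ereal_inf_lbound; exists (u, v).
have c_gt0 : 0 < 4 / (T%:R * K%:R * gamma).
  by rewrite divr_gt0// !mulr_gt0 ?ltr0n// gamma_def_u mulr_gt0.
(* A real infimum is a valid [r]. The value +oo is excluded by the finite initial loss. For -oo the
   gap is +oo, and its coefficient being positive, the right side is +oo. *)
case: E E_le => [r| |] E_le.
- rewrite -EFinB -EFinM -EFinD lee_fin; apply: mean_le => u v.
  by rewrite -lee_fin.
- by have := E_le u0 v0; rewrite leye_eq.
- by rewrite /= gt0_muley ?lte_fin// addye// leey.
Qed.
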